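(* Let $H$ be a subgraph of $K_r$ with clique number $\omega(H)$, put $\gamma=r-\omega(H)-1$, and assume $\gamma\ge1$. Let $n$ be sufficiently large (depending on $r$ and $H$). Then every graph $G^*$ in $SPEX(n,\{K_r-E(H)\}_{minor})$ contains a spanning book $B_{\gamma,n-\gamma}$ (i.e. has a spanning subgraph isomorphic to it). In particular, if $\omega(H)=2$, then $G^*\cong B^{\lfloor(n-r+3)/2\rfloor}_{r-3,n-r+3}$ if, after discarding isolated vertices, $H\cong\frac{|H|}{2}K_2$ (i.e. the edges of $H$ are pairwise disjoint), and $G^*\cong B_{r-3,n-r+3}$ otherwise.
   Context: All graphs are finite and simple; $|H|$ is the number of vertices of $H$. A graph $F$ is a minor of $G$ if $F$ can be obtained from $G$ by a sequence of vertex deletions, edge deletions and edge contractions. $SPEX(n,\{F\}_{minor})$ is the set of $n$-vertex graphs without $F$ as a minor whose spectral radius (largest adjacency eigenvalue) is maximum among all such graphs. $K_r-E(H)$ is the graph on the vertex set of $K_r$ obtained by deleting the edges of $H$. The book $B_{s,t}$ is obtained by joining every vertex of an $s$-clique to every vertex of an independent set of size $t$; $B^{k}_{s,t}$ is obtained from $B_{s,t}$ by adding $k$ isolated (pairwise disjoint) edges within its independent set. $kK_2$ is the disjoint union of $k$ edges. *)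

(* Defs.v *)
From HB Require Import structures.
From mathcomp Require Import all_boot all_order all_algebra.
From mathcomp Require Import classical_sets reals.
Set Implicit Arguments.
Unset Strict Implicit.
Unset Printing Implicit Defensive.
Import Order.TTheory GRing.Theory Num.Theory.

Record graph := Graph {
  vertex :> finType;
  adj : rel vertex;
  adj_sym : symmetric adj;
  adj_irr : irreflexive adj }.

Definition giso (G1 G2 : graph) : Prop :=
  exists2 f : G1 -> G2, bijective f & {mono f : x y / adj x y}.

(** ** Subgraphs *)

Record subgraph (G : graph) := Subgraph {
  sub_vertices : {set G};
  sub_adj : rel G;
  sub_adj_sym : symmetric sub_adj;
  sub_adj_adj : forall x y, sub_adj x y -> adj x y;
  sub_adj_vertices : forall x y, sub_adj x y -> x \in sub_vertices }.

Section Subgraphs.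
Variable G : graph.

Section GraphOfSubgraph.
Variable S : subgraph G.
Let V : finType := {x : G | x \in sub_vertices S}.
Let e : rel V := fun x y => sub_adj S (val x) (val y).

Fact graph_of_subgraph_sym : symmetric e.
Proof. by move=> x y; apply: sub_adj_sym. Qed.

Fact graph_of_subgraph_irr : irreflexive e.
Proof. by move=> x; apply/negP => /sub_adj_adj; rewrite adj_irr. Qed.

Definition graph_of_subgraph : graph :=
  Graph graph_of_subgraph_sym graph_of_subgraph_irr.
End GraphOfSubgraph.

Section Induced.
Variable A : {set G}.
Let V : finType := {x : G | x \in A}.
Let e : rel V := fun x y => adj (val x) (val y).

Fact induced_sym : symmetric e.
Proof. by move=> x y; apply: adj_sym. Qed.

Fact induced_irr : irreflexive e.
Proof. by move=> x; apply: adj_irr. Qed.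

Definition induced : graph := Graph induced_sym induced_irr.
End Induced.

Section DelEdges.
Variable S : subgraph G.
Let e : rel G := fun x y => adj x y && ~~ sub_adj S x y.

Fact del_edges_sym : symmetric e.
Proof. by move=> x y; rewrite /e adj_sym sub_adj_sym. Qed.

Fact del_edges_irr : irreflexive e.
Proof. by move=> x; rewrite /e adj_irr. Qed.

Definition del_edges : graph := Graph del_edges_sym del_edges_irr.
End DelEdges.

End Subgraphs.

Coercion graph_of_subgraph : subgraph >-> graph.

Definition has_spanning_subgraph (G F : graph) : Prop :=
  exists S : subgraph G, sub_vertices S = [set: G] /\ giso S F.

Definition discard_isolated (G : graph) : graph :=
  induced [set x : G | [exists y, adj x y]].

Definition clique (G : graph) (A : {set G}) : bool :=
  [forall x in A, forall y in A, (x != y) ==> adj x y].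

Definition clique_number (G : graph) : nat :=
  \max_(A : {set G} | clique A) #|A|.

(** ** Minors *)

Section MinorOperations.
Variable G : graph.
Implicit Types u v : G.

Definition del_vertex v : graph := induced [set~ v].

Section DelEdge.
Variables u v : G.
Let e : rel G := fun x y => adj x y && ([set x; y] != [set u; v]).

Fact del_edge_sym : symmetric e.
Proof. by move=> x y; rewrite /e adj_sym finset.setUC. Qed.

Fact del_edge_irr : irreflexive e.
Proof. by move=> x; rewrite /e adj_irr. Qed.

Definition del_edge : graph := Graph del_edge_sym del_edge_irr.
End DelEdge.

(* The vertex [u] stands for the vertex obtained by merging [u] and [v]; loops
   and multiple edges are discarded. Meant for [u], [v] adjacent. *)
Section Contract.
Variables u v : G.
Let V : finType := {x : G | x \in [set~ v]}.
Let e : rel V := fun x y =>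
  (x != y) && [|| adj (val x) (val y),
                  (val x == u) && adj v (val y) |
                  (val y == u) && adj (val x) v].

Fact contract_sym : symmetric e.
Proof.
move=> x y; rewrite /e eq_sym [adj (val y) _]adj_sym [adj v (val x)]adj_sym.
by rewrite [adj (val y) v]adj_sym; congr andb; congr orb; apply: orbC.
Qed.

Fact contract_irr : irreflexive e.
Proof. by move=> x; rewrite /e eqxx. Qed.

Definition contract : graph := Graph contract_sym contract_irr.
End Contract.

End MinorOperations.

Inductive minor (F : graph) : graph -> Prop :=
| minor_iso (G : graph) : giso F G -> minor F G
| minor_del_vertex (G : graph) (v : G) :
    minor F (del_vertex v) -> minor F G
| minor_del_edge (G : graph) (u v : G) :
    adj u v -> minor F (del_edge u v) -> minor F G
| minor_contract (G : graph) (u v : G) :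
    adj u v -> minor F (contract u v) -> minor F G.

(** ** Complete graphs, books and matchings *)

Section Complete.
Variable r : nat.
Let e : rel 'I_r := fun i j => i != j.

Fact complete_sym : symmetric e.
Proof. by move=> i j; rewrite /e eq_sym. Qed.

Fact complete_irr : irreflexive e.
Proof. by move=> i; rewrite /e eqxx. Qed.

Definition complete : graph := Graph complete_sym complete_irr.
End Complete.

(* The graph on [t] vertices whose edges are {2l, 2l+1} for l < k; it has
   exactly [k] edges when [k.*2 <= t]. *)
Section PartialMatching.
Variables t k : nat.
Let e : rel 'I_t := fun i j => [&& i != j, i./2 == j./2 & i./2 < k].

Fact partial_matching_sym : symmetric e.
Proof.
by move=> i j; rewrite /e eq_sym [j./2 == _]eq_sym; case: eqP => //= _; case: eqP => // ->.
Qed.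

Fact partial_matching_irr : irreflexive e.
Proof. by move=> i; rewrite /e eqxx. Qed.

Definition partial_matching : graph :=
  Graph partial_matching_sym partial_matching_irr.
End PartialMatching.

Definition edgeless (t : nat) : graph := partial_matching t 0.

Definition copies_K2 (k : nat) : graph := partial_matching k.*2 k.

Section Join.
Variables G1 G2 : graph.
Let V : finType := (G1 + G2)%type.
Let e : rel V := fun x y =>
  match x, y with
  | inl a, inl b => adj a b
  | inr a, inr b => adj a b
  | _, _ => true
  end.

Fact join_sym : symmetric e.
Proof. by move=> [a|a] [b|b] //=; apply: adj_sym. Qed.

Fact join_irr : irreflexive e.
Proof. by move=> [a|a] /=; apply: adj_irr. Qed.

Definition join : graph := Graph join_sym join_irr.
End Join.

Definition book (s t : nat) : graph := join (complete s) (edgeless t).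

(* B^k_{s,t}, for [k.*2 <= t]. *)
Definition book_edges (k s t : nat) : graph :=
  join (complete s) (partial_matching t k).

(** ** Spectral extremal graphs *)

Section Spectral.
Variable R : realType.
Local Open Scope ring_scope.
Local Open Scope classical_set_scope.

Definition adjacency_mx (G : graph) : 'M[R]_#|G| :=
  \matrix_(i, j) (adj (enum_val i) (enum_val j))%:R.

(* A finite set of eigenvalues, nonempty when [G] has a vertex, so that the
   supremum is a maximum. *)
Definition spectral_radius (G : graph) : R :=
  sup [set a : R | eigenvalue (adjacency_mx G) a].

Definition in_SPEX_minor (n : nat) (F G : graph) : Prop :=
  [/\ #|G| = n, ~ minor F G &
      forall G' : graph, #|G'| = n -> ~ minor F G' ->
        spectral_radius G' <= spectral_radius G].

End Spectral.

(* Main.v *)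
Require Import Defs.
From mathcomp Require Import all_boot all_order all_algebra.
From mathcomp Require Import classical_sets reals.
From mathcomp Require Import boolp functions topology normedtype derive.
From mathcomp Require Import zify ring lra.
From mathcomp Require Import eqtype fintype finset.
Set Implicit Arguments.
Unset Strict Implicit.
Unset Printing Implicit Defensive.
Import Order.TTheory GRing.Theory Num.Theory.
Import numFieldNormedType.Exports.

(** Write F for K_r - E(H), omega for the clique number of H and
gamma = r - omega - 1. Cliques of H are the independent sets of F, so omega is
the independence number of F, and this is all that the first part uses.

On one side, B_{gamma,n-gamma} has no F minor: a model of F has at least
omega + 1 branch sets that avoid the gamma hubs, hence two adjacent branch sets
inside an independent set ([independent_rest_model_free]). So an extremal graph
G has lambda^2 >= gamma (n - gamma), where lambda is its spectral radius
([book_radius]). On the other side, K_{gamma+1,r} has an F minor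
([biclique_model]), so G does not contain it; and F is a subgraph of K_r, so
every induced subgraph of G has linearly many edges ([mader]).

These facts locate the large entries of the Perron vector z of G, scaled to
maximum 1. Expanding lambda^2 z_v over the walks of length two from v, a vertex
of weight at least delta has linear degree, so there are boundedly many of them;
all but boundedly many vertices see at most gamma of these, as K_{gamma+1,r} is
absent; and lambda^2 >= gamma (n - gamma) can then only hold if some vertex sees
exactly gamma of them, all of weight close to 1. These gamma vertices form the
set L of hubs. Almost every vertex is adjacent to all of L, and every vertex
outside L has small weight ([hubs_eventually]).

It remains to see that G joins L completely. Otherwise G is rewired ([rewire]):
L becomes a clique, a bounded number of vertices of small degree that were
already joined to L lose their other edges, and so does one deficient vertex,
which is joined to L. This strictly increases the spectral radius
([rewire_radius_lt]): every weight outside L is small, so what is lost is small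
in comparison with one new edge to a hub. It creates no F minor
([rewire_has_model]): the vertices that lost their edges supply enough private
neighbours of all of L to replace whatever the new edges contribute to a model.
Rewiring the deficient vertex alone could create an F minor. The contradiction
proves [extremal_hubs].

When omega = 2 we have gamma = r - 3, so that G is the join of K_{r-3} and some Q,
and a model of F only has to place three vertices of F in Q. If H has two
incident edges, some three vertices of F span at most one edge, so Q has no edge.
If the edges of H are disjoint, any three vertices of F contain a path on three
vertices, and some three span just that path; so G has no F minor if and only if
Q is a matching, and as adding an edge increases the spectral radius
([add_edge_radius]), Q is a matching with at most one uncovered vertex. *)

(** * Minors and branch sets *)

Definition nbr (G : graph) (x : G) : {set G} := [set y | adj x y].

(** Connectedness in terms of cuts, which behaves well under contraction and
    under exchanging vertices, and avoids walks altogether. *)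
Definition connected_set (G : graph) (A : {set G}) : Prop :=
  forall B : {set G}, B \subset A -> B != set0 -> B != A ->
  exists x y, [/\ x \in B, y \in A :\: B & adj x y].

Definition touch (G : graph) (A B : {set G}) : Prop :=
  exists x y, [/\ x \in A, y \in B & adj x y].

Record is_model (F G : graph) (phi : F -> {set G}) : Prop := IsModel {
  model_neq0 : forall f, phi f != set0;
  model_connected : forall f, connected_set (phi f);
  model_disjoint : forall f g x, x \in phi f -> x \in phi g -> f = g;
  model_touch : forall f g, adj f g -> touch (phi f) (phi g) }.

Definition has_model (F G : graph) : Prop :=
  exists phi : F -> {set G}, is_model phi.

Lemma connected_set1 (G : graph) (x : G) : connected_set [set x].
Proof.
by move=> B; rewrite subset1 => /orP [] /eqP ->; rewrite eqxx.
Qed.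

Lemma connected_set2 (G : graph) (x y : G) : adj x y -> connected_set [set x; y].
Proof.
move=> xy B sB B0 BA.
have [xB|xB] := boolP (x \in B); have [yB|yB] := boolP (y \in B).
- case/negP: BA; rewrite eqEsubset sB /=; apply/subsetP=> z.
  by rewrite !inE => /orP [] /eqP ->.
- by exists x, y; rewrite !inE eqxx orbT yB.
- by exists y, x; rewrite !inE eqxx xB adj_sym.
- case/set0Pn: B0 => z zB; move/subsetP: sB => /(_ z zB).
  by rewrite !inE => /orP [] /eqP zE; rewrite -zE zB in xB yB.
Qed.

Lemma connected_set_edge (G : graph) (A : {set G}) (x y : G) :
  connected_set A -> x \in A -> y \in A -> x != y ->
  exists2 z, z \in A & adj x z.
Proof.
move=> cA xA yA xy; have [|||u [z [+ + uz]]] := cA [set x].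
- by rewrite sub1set.
- by apply/set0Pn; exists x; rewrite inE.
- apply/eqP=> AE; move: yA; rewrite -AE inE eq_sym => yx; by rewrite yx in xy.
by rewrite !inE => /eqP <- /andP [_ zA]; exists z.
Qed.

Lemma imset_model (F G1 G2 : graph) (h : G1 -> G2) (phi : F -> {set G1}) :
  injective h -> (forall x y, adj x y -> adj (h x) (h y)) ->
  is_model phi -> is_model (fun f => h @: phi f).
Proof.
move=> hI hadj [p0 pc pd pt]; split.
- by move=> f; rewrite imset_eq0.
- move=> f B sB B0 BA.
  have BE : B = h @: (h @^-1: B).
    apply/setP=> z; apply/idP/imsetP => [zB|[x + ->]]; last by rewrite inE.
    move/subsetP: (sB) => /(_ z zB) /imsetP [x xf zE].
    by exists x => //; rewrite inE -zE.
  have [|||x [y [xB + xy]]] := pc f (h @^-1: B).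
  + apply/subsetP=> x; rewrite inE => hx.
    move/subsetP: (sB) => /(_ _ hx) /imsetP [x' x'f /hI ->]; exact: x'f.
  + by apply: contra_neq B0 => B0; rewrite BE B0 imset0.
  + by apply: contra_neq BA => BA; rewrite BE BA.
  rewrite !inE in xB * => /andP [yB yf].
  exists (h x), (h y); split; rewrite ?inE ?yB ?hadj //=.
  by rewrite imset_f.
- move=> f g z /imsetP [x xf ->] /imsetP [y yg /hI xy].
  by apply: (pd f g x) => //; rewrite xy.
- move=> f g /pt [x [y [xf yg xy]]]; exists (h x), (h y).
  by rewrite !imset_f ?hadj.
Qed.

Lemma has_model_hom (F G1 G2 : graph) (h : G1 -> G2) :
  injective h -> (forall x y, adj x y -> adj (h x) (h y)) ->
  has_model F G1 -> has_model F G2.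
Proof.
move=> hI hadj [phi mphi]; exists (fun f => h @: phi f); exact: imset_model.
Qed.

Lemma has_model_sub (F F' G : graph) (h : F -> F') :
  injective h -> (forall x y, adj x y -> adj (h x) (h y)) ->
  has_model F' G -> has_model F G.
Proof.
move=> hI hadj [phi [p0 pc pd pt]]; exists (fun f => phi (h f)); split=> //.
- by move=> f g x xf xg; apply/hI/(pd _ _ x).
- by move=> f g /hadj /pt.
Qed.

Lemma has_model_refl (G : graph) : has_model G G.
Proof.
exists (fun x => [set x]); split.
- by move=> f; apply/set0Pn; exists f; rewrite inE.
- exact: connected_set1.
- by move=> f g x; rewrite !inE => /eqP <- /eqP.
- by move=> f g fg; exists f, g; rewrite !inE.
Qed.

Lemma adj_contractE (G : graph) (u v : G) (x y : contract u v) :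
  adj x y = (x != y) && [|| adj (val x) (val y),
                  (val x == u) && adj v (val y) |
                  (val y == u) && adj (val x) v].
Proof. by []. Qed.

Lemma neq_val_contract (G : graph) (u v : G) (x : contract u v) : val x != v.
Proof. by have := valP x; rewrite !inE. Qed.

Lemma contract_vertexP (G : graph) (u v x : G) :
  x != v -> exists x' : contract u v, val x' = x.
Proof.
move=> xv; have xP : x \in [set~ v] by rewrite !inE.
by exists (exist _ x xP).
Qed.

(** The preimage of S under the contraction map, which sends v to u. *)
Definition uncontract (G : graph) (u v : G) (S : {set contract u v}) : {set G} :=
  [set x | [exists y in S, val y == (if x == v then u else x)]].

Section Uncontract.
Variables (G : graph) (u v : G).
Hypothesis uv : adj u v.

Lemma contract_neq : u != v.
Proof. by apply: contraTneq uv => ->; rewrite adj_irr. Qed.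

Lemma mem_uncontract (S : {set contract u v}) (y : contract u v) :
  (val y \in uncontract S) = (y \in S).
Proof.
rewrite inE (negPf (neq_val_contract y)).
apply/existsP/idP => [[z /andP [zS /eqP /val_inj <-]] //|yS].
by exists y; rewrite yS eqxx.
Qed.

Lemma uncontract_merged (S : {set contract u v}) :
  (v \in uncontract S) = (u \in uncontract S).
Proof. by rewrite !inE eqxx (negPf contract_neq). Qed.

(** x' is the image of x under the contraction map; membership statements about
    preimages reduce to statements about x'. *)
Lemma uncontract_point (x : G) : exists x' : contract u v,
  forall S : {set contract u v}, (x \in uncontract S) = (x' \in S).
Proof.
have [x' x'E] : exists x' : contract u v, val x' = if x == v then u else x.
  by apply: contract_vertexP; case: (eqVneq x v) => // _; apply: contract_neq.
exists x' => S; rewrite -mem_uncontract x'E.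
by case: (eqVneq x v) => // ->; rewrite uncontract_merged.
Qed.

Lemma uncontractK (B : {set G}) : (u \in B) = (v \in B) ->
  uncontract [set y : contract u v | val y \in B] = B.
Proof.
move=> uvB; apply/setP=> x; have [->|xv] := eqVneq x v.
  rewrite uncontract_merged -uvB; have [u' u'E] := contract_vertexP u contract_neq.
  by rewrite -[X in X \in uncontract _]u'E mem_uncontract inE u'E.
by have [x' <-] := contract_vertexP u xv; rewrite mem_uncontract inE.
Qed.

Lemma preim_uncontract (S : {set contract u v}) :
  [set y : contract u v | val y \in uncontract S] = S.
Proof. by apply/setP=> y; rewrite inE mem_uncontract. Qed.

Lemma uncontractD (S T : {set contract u v}) :
  uncontract (S :\: T) = uncontract S :\: uncontract T.
Proof.
by apply/setP=> x; have [x' E] := uncontract_point x; rewrite in_setD !E in_setD.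
Qed.

Lemma uncontract0 : @uncontract G u v set0 = set0.
Proof. by apply/setP=> x; rewrite !inE; apply/existsP=> -[y]; rewrite inE. Qed.

Lemma touch_uncontract (S T : {set contract u v}) :
  touch S T -> touch (uncontract S) (uncontract T).
Proof.
move=> [x [y [xS yT]]]; rewrite adj_contractE => /andP [_].
have [xS' yT'] : val x \in uncontract S /\ val y \in uncontract T.
  by split; rewrite mem_uncontract.
case/or3P=> [xy|/andP [/eqP xu vy]|/andP [/eqP yu xv]].
- by exists (val x), (val y).
- by exists v, (val y); rewrite uncontract_merged; split=> //; move: xS'; rewrite xu.
- by exists (val x), v; rewrite uncontract_merged; split=> //; move: yT'; rewrite yu.
Qed.

(** Disjointness is needed because the edge uv itself is lost. *)
Lemma touch_contract (S T : {set contract u v}) : [disjoint S & T] ->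
  touch (uncontract S) (uncontract T) -> touch S T.
Proof.
move=> dST [x [y [xS yT xy]]].
pose nf z := if z == v then u else z.
have nfE A z : z \in @uncontract G u v A -> nf z \in uncontract A.
  by rewrite /nf; case: eqP => // ->; rewrite uncontract_merged.
have nfv z : nf z != v by rewrite /nf; case: (eqVneq z v) => // _; apply: contract_neq.
have [x' x'E] := contract_vertexP u (nfv x).
have [y' y'E] := contract_vertexP u (nfv y).
have x'S : x' \in S by rewrite -mem_uncontract x'E nfE.
have y'T : y' \in T by rewrite -mem_uncontract y'E nfE.
exists x', y'; split; rewrite // adj_contractE; apply/andP; split.
  by apply: contraTneq x'S => ->; rewrite (disjointFl dST).
rewrite x'E y'E /nf; case: (eqVneq x v) (xy) => [->|xv].
  case: (eqVneq y v) => [->|yv]; first by rewrite adj_irr.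
  by rewrite eqxx => ->; rewrite orbT.
case: (eqVneq y v) => [-> ->|yv ->]; by rewrite ?eqxx ?orbT.
Qed.

(** A cut of the preimage that separates u from v is crossed by the edge uv; any
    other cut is the preimage of a cut of S. *)
Lemma connected_uncontract (S : {set contract u v}) :
  connected_set (uncontract S) <-> connected_set S.
Proof.
split=> cS B sB B0 BS.
  have := cS (uncontract B); rewrite -uncontractD => -[|||x [y [xB yB xy]]].
  - apply/subsetP=> x; have [x' E] := uncontract_point x.
    by rewrite !E; apply: subsetP.
  - by apply: contra_neq B0 => B0; rewrite -(preim_uncontract B) B0;
      apply/setP=> y; rewrite !inE.
  - by apply: contra_neq BS => BS; rewrite -(preim_uncontract B) BS preim_uncontract.
  apply: touch_contract; last by exists x, y.
  by rewrite -setI_eq0; apply/eqP/setP=> z; rewrite !inE; case: (z \in B).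
have [uvB|uvB] := eqVneq (u \in B) (v \in B).
  rewrite -(uncontractK uvB) -uncontractD; apply: touch_uncontract.
  apply: cS.
  - by apply/subsetP=> x; rewrite inE -(mem_uncontract S); apply: subsetP.
  - by apply: contra_neq B0 => B0; rewrite -(uncontractK uvB) B0 uncontract0.
  - by apply: contra_neq BS => BS; rewrite -(uncontractK uvB) BS.
have [uS vS] : u \in uncontract S /\ v \in uncontract S.
  rewrite uncontract_merged; case: (boolP (u \in B)) uvB => [uB _|_].
    by rewrite (subsetP sB).
  by case: (boolP (v \in B)) => // vB _; rewrite -uncontract_merged (subsetP sB).
case: (boolP (u \in B)) uvB => [uB|uB].
  case: (boolP (v \in B)) => // vB _.
  by exists u, v; split=> //; rewrite in_setD vB.
case: (boolP (v \in B)) => // vB _.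
by exists v, u; split; rewrite // 1?adj_sym // in_setD uB.
Qed.

End Uncontract.

Lemma has_model_contract (F G : graph) (u v : G) :
  adj u v -> has_model F (contract u v) -> has_model F G.
Proof.
move=> uv [phi [p0 pc pd pt]]; exists (fun f => uncontract (phi f)); split.
- move=> f; have /set0Pn [x xf] := p0 f.
  by apply/set0Pn; exists (val x); rewrite mem_uncontract.
- by move=> f; apply/connected_uncontract.
- by move=> f g x; have [x' E] := uncontract_point uv x; rewrite !E; apply: pd.
- by move=> f g /pt /touch_uncontract; apply.
Qed.

Lemma minor_has_model (F G : graph) : minor F G -> has_model F G.
Proof.
elim=> {G} [G [h hB hM]|G v _|G u v uv _|G u v uv _ IH].
- apply: (has_model_hom (bij_inj hB) _ (has_model_refl F)).
  by move=> x y; rewrite hM.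
- by apply: (@has_model_hom F (del_vertex v) G val) => //; apply: val_inj.
- by apply: (@has_model_hom F (del_edge u v) G id) => // x y /andP [].
- exact: has_model_contract IH.
Qed.

Lemma card_contract (G : graph) (u v : G) : #|contract u v| = #|G|.-1.
Proof. by rewrite card_sig cardsC1. Qed.

Lemma card_induced (G : graph) (A : {set G}) : #|induced A| = #|A|.
Proof. by rewrite card_sig. Qed.

(** The superfluous edges are deleted one at a time. *)
Lemma minor_bij_hom (F G : graph) (h : F -> G) :
  bijective h -> (forall x y, adj x y -> adj (h x) (h y)) -> minor F G.
Proof.
pose arcs (G : graph) := #|[set p : G * G | adj p.1 p.2]|.
have [m] := ubnP (arcs G); elim: m G h => // m IH G h mG hB hadj.
have [/existsP [x /existsP [y /andP [hxy nxy]]]|none] :=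
    boolP [exists x, exists y, adj (h x) (h y) && ~~ adj x y]; last first.
  apply: minor_iso; exists h => // x y; apply/idP/idP; last exact: hadj.
  move=> hxy; apply: contraNT none => nxy.
  by apply/existsP; exists x; apply/existsP; exists y; rewrite hxy.
apply: (minor_del_edge hxy); apply: (IH (del_edge (h x) (h y)) h) => //.
  rewrite ltnS in mG; apply: leq_trans mG; apply: proper_card.
  apply/properP; split; first by apply/subsetP=> p; rewrite !inE => /andP [].
  by exists (h x, h y); rewrite !inE //= negb_and eqxx orbT.
move=> a b ab; rewrite /adj /= hadj //=; apply/eqP=> /setP E.
have hI := bij_inj hB.
have aE : (a == x) || (a == y).
  by have := E (h a); rewrite !inE eqxx /= !(inj_eq hI) => <-.
have bE : (b == x) || (b == y).
  by have := E (h b); rewrite !inE eqxx orbT /= !(inj_eq hI) => <-.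
move: ab; case/orP: aE => /eqP->; case/orP: bE => /eqP->; rewrite ?adj_irr //.
  by rewrite (negPf nxy).
by rewrite adj_sym (negPf nxy).
Qed.

(** Induction on the order of G: contract an edge inside a branch set with at
    least two vertices; once all branch sets are singletons, delete the vertices
    outside them and then the superfluous edges. *)
Lemma has_model_minor (F G : graph) : has_model F G -> minor F G.
Proof.
have [m] := ubnP #|G|; elim: m G => // m IH G mG [phi [p0 pc pd pt]].
have [/existsP [f /card_gt1P [u [w [uf wf uw]]]]|small] :=
    boolP [exists f, 1 < #|phi f|].
  have [v vf uv] := connected_set_edge (pc f) uf wf uw.
  apply: (minor_contract uv); apply: IH.
    rewrite card_contract; have : 0 < #|G| by apply/card_gt0P; exists u.
    by lia.
  have phiK g : uncontract [set x : contract u v | val x \in phi g] = phi g.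
    apply: uncontractK => //; apply/idP/idP=> [ug|vg].
      by rewrite -(pd _ _ _ uf ug).
    by rewrite -(pd _ _ _ vf vg).
  exists (fun g => [set x | val x \in phi g]); split.
  - move=> g; apply: contra_neq (p0 g) => E.
    by rewrite -phiK E uncontract0.
  - by move=> g; apply/(connected_uncontract uv); rewrite phiK.
  - by move=> g g' x; rewrite !inE; apply: pd.
  - move=> g g' gg'; apply: touch_contract => //; last by rewrite !phiK; apply: pt.
    rewrite -setI_eq0; apply/eqP/setP=> x; rewrite !inE.
    apply/negP=> /andP [xg xg']; have E := pd _ _ _ xg xg'.
    by rewrite E adj_irr in gg'.
have single f : exists x, phi f == [set x].
  suff /cards1P [x ->] : #|phi f| == 1 by exists x.
  rewrite eqn_leq card_gt0 p0 andbT leqNgt.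
  by apply: contra small => ?; apply/existsP; exists f.
pose h f := xchoose (single f).
have hE f : phi f = [set h f] by apply/eqP/(xchooseP (single f)).
have hI : injective h.
  by move=> f g fg; apply: (pd _ _ (h f)); rewrite hE inE // fg.
have hadj f g : adj f g -> adj (h f) (h g).
  by move=> /pt [x [y]]; rewrite !hE !inE => -[/eqP -> /eqP ->].
have [/existsP [v vP]|surj] := boolP [exists v, v \notin codom h]; last first.
  apply: (@minor_bij_hom F G h) => //; apply: inj_card_bij => //.
  rewrite -(card_codom hI); apply/subset_leq_card/subsetP=> x _.
  by apply: contraNT surj => xh; apply/existsP; exists x.
apply: (@minor_del_vertex F G v); apply: IH.
  rewrite card_induced cardsC1; have : 0 < #|G| by apply/card_gt0P; exists v.
  by lia.
have hv f : h f \in [set~ v].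
  by rewrite !inE; apply: contraNneq vP => <-; apply: codom_f.
apply: (@has_model_hom F F (del_vertex v) (fun f => exist _ (h f) (hv f))).
- by move=> f g [/hI].
- by move=> f g /hadj.
- exact: has_model_refl.
Qed.

(** * Sparseness of minor-free graphs *)
Lemma adj_neq (G : graph) (x y : G) : adj x y -> x != y.
Proof. by apply: contraTneq => ->; rewrite adj_irr. Qed.

Lemma sum_nbr_induced (G : graph) (A : {set G}) :
  \sum_(x : induced A) #|nbr x| = \sum_(x in A) #|nbr x :&: A|.
Proof.
rewrite [RHS](reindex_omap (val : induced A -> G) insub) => [|x xA]; last first.
  by rewrite insubT.
apply: congr_big => // [x|x _]; first by rewrite (valP x) valK eqxx.
rewrite -(card_imset _ (val_inj : injective (val : induced A -> G))).
apply: eq_card => y; rewrite in_setI inE; apply/imsetP/andP=> [[z + ->]|[xy yA]].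
  by rewrite inE => xz; split=> //; apply: valP.
by exists (exist _ y yA); rewrite ?inE.
Qed.

Definition arcs (G : graph) : {set G * G} := [set p | adj p.1 p.2].

Lemma sum_nbr_arcs (G : graph) : \sum_(x : G) #|nbr x| = #|arcs G|.
Proof.
rewrite -sum1_card (eq_bigl (fun p : G * G => true && adj p.1 p.2)); last first.
  by move=> p; rewrite inE.
rewrite -(pair_big_dep xpredT (fun x y => adj x y) (fun _ _ => 1)).
by apply: eq_bigr => x _; rewrite -sum1_card; apply: eq_bigl => y; rewrite inE.
Qed.

(** The arcs lost in a contraction are uv, vu and, for each common neighbour of u
    and v, the two arcs joining it to v; all others keep distinct images. *)
Lemma card_arcs_contract (G : graph) (u v : G) : adj u v ->
  #|arcs G| <= #|arcs (contract u v)| + 2 + 2 * #|nbr u :&: nbr v|.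
Proof.
move=> uv; have nuv := adj_neq uv.
pose nf z := if z == v then u else z.
have nfv z : nf z != v by rewrite /nf; case: (eqVneq z v).
pose common := nbr u :&: nbr v.
pose lost := [set (u, v); (v, u)] :|:
  ([set (v, y) | y in common] :|: [set (y, v) | y in common]).
have lost_le : #|lost| <= 2 + 2 * #|common|.
  apply: leq_trans (leq_card_setU _ _) _; apply: leq_add.
    by rewrite cards2; case: (_ != _).
  apply: leq_trans (leq_card_setU _ _) _; rewrite mul2n -addnn.
  by apply: leq_add; apply: leq_imset_card.
pose g (p : G * G) := (nf p.1, nf p.2).
have gE p q : p \in arcs G :\: lost -> q \in arcs G :\: lost -> g p = g q -> p = q.
  have keep a b : (a, b) \in arcs G :\: lost ->
      [/\ adj a b, a = v -> ~~ adj u b && (b != u) & b = v -> ~~ adj a u && (a != u)].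
    rewrite in_setD !in_setU !negb_or => /andP [/and3P [/andP [uvP vuP] vyP yvP]].
    rewrite inE /= => ab; split=> // E; rewrite {}E in ab uvP vuP vyP yvP *.
      apply/andP; split.
        apply: contra vyP => ub; apply/imsetP; exists b => //.
        by rewrite in_setI !inE ub.
      by apply: contra vuP => /eqP ->; rewrite inE.
    apply/andP; split.
      apply: contra yvP => ub; apply/imsetP; exists a => //.
      by rewrite in_setI !inE adj_sym ub adj_sym.
    by apply: contra uvP => /eqP ->; rewrite inE.
  case: p q => [a b] [c d] /keep [ab a1 b1] /keep [cd c1 d1] [].
  rewrite /nf.
  have [aE|av] := eqVneq a v; have [cE|cv] := eqVneq c v;
  have [bE|bv] := eqVneq b v; have [dE|dv] := eqVneq d v => // E1 E2; subst;
  rewrite ?adj_irr // in ab cd *;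
    try (by move: (a1 erefl); rewrite ?cd ?ab ?eqxx ?andbF);
    try (by move: (b1 erefl); rewrite ?cd ?ab ?eqxx ?andbF);
    try (by move: (c1 erefl); rewrite ?cd ?ab ?eqxx ?andbF);
    by move: (d1 erefl); rewrite ?cd ?ab ?eqxx ?andbF.
have gI : {in arcs G :\: lost &, injective g} by move=> p q; apply: gE.
pose h (p : contract u v * contract u v) := (val p.1, val p.2).
have sub : g @: (arcs G :\: lost) \subset h @: arcs (contract u v).
  apply/subsetP=> _ /imsetP [[a b] abP ->].
  have [a' a'E] := contract_vertexP u (nfv a).
  have [b' b'E] := contract_vertexP u (nfv b).
  apply/imsetP; exists (a', b'); last by rewrite /h /g /= a'E b'E.
  move: abP; rewrite in_setD => /andP [abl]; rewrite inE /= => ab.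
  suff : adj a' b' by rewrite inE.
  rewrite adj_contractE -(inj_eq val_inj) a'E b'E /nf.
  have [aE|av] := eqVneq a v; have [bE|bv] := eqVneq b v; rewrite ?eqxx /=.
  - by rewrite aE bE adj_irr in ab.
  - rewrite aE in ab abl; rewrite ab orbT andbT; apply: contraNneq abl => <-.
    by rewrite !in_setU !inE eqxx orbT.
  - rewrite bE in ab abl; rewrite ab !orbT andbT; apply: contraNneq abl => ->.
    by rewrite !in_setU !inE eqxx.
  - by rewrite ab (adj_neq ab).
have := cardsID lost (arcs G).
have := subset_leq_card sub; rewrite card_in_imset // card_imset; last first.
  by move=> [a b] [c d] [/val_inj -> /val_inj ->].
have := subset_leq_card (finset.subsetIr (arcs G) lost).
move=> le1 le2 <-; apply: leq_trans (leq_add (leq_trans le1 lost_le) le2) _.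
by rewrite -/common addnC addnA.
Qed.

(** Mader's argument, with the crude constant 2^r. If some contraction keeps the
    density, induct on the order. Otherwise every edge lies in at least 2^r
    triangles, so the neighbourhood of a non-isolated vertex u is dense enough to
    contain the previous complete minor, to which u is added. *)
Lemma mader r (G : graph) : 0 < #|G| ->
  2 ^ r * #|G| <= \sum_(x : G) #|nbr x| -> has_model (complete r) G.
Proof.
elim: r G => [|r IHr] G.
  move=> _ _; exists (fun _ => set0).
  by split=> -[].
have [m] := ubnP #|G|; elim: m G => // m IH G mG G0 big.
have [/existsP [u /existsP [v /andP [uv]]]|none] :=
  boolP [exists u, exists v, @adj G u v &&
   (2 ^ r.+1 * #|contract u v| <= \sum_(x : contract u v) #|nbr x|)].
  move=> big'; apply: (has_model_contract uv); apply: IH big'.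
    by rewrite (card_contract u v); lia.
  rewrite (card_contract u v).
  have : 1 < #|G| by apply/card_gt1P; exists u, v; rewrite (adj_neq uv).
  by lia.
have codeg u v : @adj G u v -> 2 ^ r <= #|nbr u :&: nbr v|.
  move=> uv; rewrite leqNgt; apply: contra none => small.
  apply/existsP; exists u; apply/existsP; exists v; rewrite uv /=.
  have := card_arcs_contract uv; rewrite -!sum_nbr_arcs (card_contract u v); move: big.
  rewrite -(prednK G0) /= expnS; move: small G0 => /ssrnat.leP small _.
  set a := \sum_x _; set b := \sum_x _.
  move: small; set p := 2 ^ r; set c := #|_ :&: _|; set g := #|G|.-1; nia.
have [u [v uv]] : exists u v : G, adj u v.
  have : 0 < \sum_(x : G) #|nbr x| by apply: leq_trans big; rewrite muln_gt0 expn_gt0.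
  rewrite lt0n sum_nat_eq0 negb_forall => /existsP [u]; rewrite /= cards_eq0.
  by case/set0Pn => v; rewrite inE => uv; exists u, v.
have [||phi [p0 pc pd pt]] := IHr (induced (nbr u)).
- by rewrite card_induced; apply/card_gt0P; exists v; rewrite inE.
- rewrite sum_nbr_induced card_induced mulnC -sum_nat_const; apply: leq_sum => x.
  by rewrite inE => /codeg; rewrite finset.setIC.
pose psi (i : complete r.+1) : {set G} :=
  if unlift ord0 i is Some j then val @: phi j else [set u].
have valI : injective (val : induced (nbr u) -> G) by apply: val_inj.
have unbr (x : induced (nbr u)) : adj u (val x) by have := valP x; rewrite inE.
have phi_set j : connected_set [set val x | x in phi j].
  have vadj (x y : induced (nbr u)) : adj x y -> adj (val x) (val y) by [].
  exact: (model_connected (imset_model valI vadj (IsModel p0 pc pd pt))).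
exists psi; split; rewrite /psi.
- move=> i; case: unliftP => [j|] _; first by rewrite imset_eq0.
  by apply/set0Pn; exists u; rewrite inE.
- by move=> i; case: unliftP => [j|] _; [exact: phi_set|exact: connected_set1].
- move=> i j x; case: unliftP => [i'|] ->; case: unliftP => [j'|] -> //.
  + by case/imsetP=> y yi -> /imsetP [z zj /val_inj yz]; rewrite (pd i' j' y) // yz.
  + by case/imsetP=> y _ ->; rewrite inE => /eqP E; have := unbr y; rewrite E adj_irr.
  + by rewrite inE => /eqP -> /imsetP [y _ E]; have := unbr y; rewrite -E adj_irr.
- move=> i j; case: unliftP => [i'|] ->; case: unliftP => [j'|] -> ij.
  + have /pt [x [y [xi yj xy]]] : @adj (complete r) i' j'.
      by apply: contra ij => /eqP ->.
    by exists (val x), (val y); rewrite !imset_f.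
  + have /set0Pn [x xi] := p0 i'; exists (val x), u.
    by rewrite imset_f // inE eqxx adj_sym.
  + have /set0Pn [x xi] := p0 j'; exists u, (val x).
    by rewrite imset_f // inE eqxx.
  + by rewrite adj_irr in ij.
Qed.

Lemma has_model_complete (F G : graph) :
  has_model (complete #|F|) G -> has_model F G.
Proof.
apply: (@has_model_sub F (complete #|F|) G enum_rank); first exact: enum_rank_inj.
move=> x y xy; rewrite /adj /= (inj_eq enum_rank_inj); exact: adj_neq.
Qed.

Lemma model_free_sparse (F G : graph) (A : {set G}) : ~ has_model F G ->
  \sum_(x in A) #|nbr x :&: A| <= 2 ^ #|F| * #|A|.
Proof.
move=> nF; have [->|/set0Pn [a aA]] := eqVneq A set0.
  by rewrite big_set0.
rewrite leqNgt; apply/negP=> /ltnW dense; apply: nF; apply: has_model_complete.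
apply: (@has_model_hom _ (induced A) G val val_inj) => //.
apply: mader; first by rewrite card_induced; apply/card_gt0P; exists a.
by rewrite card_induced sum_nbr_induced.
Qed.

Lemma inj_into (T G : finType) (g0 : G) (A : {set T}) (U : {set G}) :
  #|A| <= #|U| -> exists2 j : T -> G,
    {in A &, injective j} & {in A, forall t, j t \in U}.
Proof.
move=> AU; pose j (t : T) : G := nth g0 (enum U) (index t (enum A)).
have idx t : t \in A -> index t (enum A) < size (enum U).
  by move=> tA; rewrite -cardE; apply: leq_trans AU; rewrite cardE index_mem mem_enum.
exists j => [t t' tA t'A /eqP|t tA]; last by rewrite -mem_enum mem_nth ?idx.
rewrite nth_uniq ?enum_uniq ?idx // => /eqP /(index_inj t); apply;
  by rewrite mem_enum.
Qed.

(** Each vertex of the independent set A is represented by one vertex of Y, and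
    each other vertex f by an edge x_f y_f of the biclique: two such edges are
    adjacent crosswise, and x_f is adjacent to all of Y. *)
Lemma biclique_model (F G : graph) (A : {set F}) (X Y : {set G}) :
  (forall f g, f \in A -> g \in A -> ~~ adj f g) ->
  #|~: A| <= #|X| -> #|F| <= #|Y| -> [disjoint X & Y] ->
  (forall x y, x \in X -> y \in Y -> adj x y) -> has_model F G.
Proof.
move=> indA leX leY dXY XY.
have [/card0_eq F0|/card_gt0P [f0 _]] := posnP #|F|.
  exists (fun _ => set0); split=> f; by have := F0 f.
have /card_gt0P [y0 _] : 0 < #|Y| by apply: leq_trans leY; apply/card_gt0P; exists f0.
have [b bI0 bY0] : exists2 b : F -> G, {in [set: F] &, injective b}
    & {in [set: F], forall t, b t \in Y} by apply: inj_into; rewrite ?cardsT.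
have bY f : b f \in Y by apply: bY0; rewrite inE.
have bI : injective b by move=> f g; apply: bI0; rewrite inE.
have [a aI0 aX0] := inj_into y0 leX.
have aX f : f \notin A -> a f \in X by move=> fA; apply: aX0; rewrite inE.
have aI f g : f \notin A -> g \notin A -> a f = a g -> f = g.
  by move=> fA gA; apply: aI0; rewrite inE.
have ab f g : f \notin A -> adj (a f) (b g) by move=> fA; apply: XY; auto.
have anb f g : f \notin A -> a f != b g by move/ab => /(_ g) /adj_neq.
exists (fun f => if f \in A then [set b f] else [set a f; b f]); split.
- move=> f; apply/set0Pn; exists (b f); by case: ifP; rewrite !inE eqxx ?orbT.
- move=> f; case: ifP => fA; first exact: connected_set1.
  by apply/connected_set2/ab/negbT.
- move=> f g x; case: ifPn => fA; case: ifPn => gA; rewrite !inE.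
  + by move=> /eqP -> /eqP /bI.
  + by move=> /eqP -> /orP [] /eqP; [move=> E; have := anb g f gA; rewrite E eqxx|exact: bI].
  + by move=> /orP [] /eqP -> /eqP; [move=> E; have := anb f g fA; rewrite E eqxx|exact: bI].
  + move=> /orP [] /eqP -> /orP [] /eqP.
    * exact: aI.
    * by move=> E; have := anb f g fA; rewrite E eqxx.
    * by move=> E; have := anb g f gA; rewrite E eqxx.
    * exact: bI.
- move=> f g fg; have [fA|fA] := boolP (f \in A).
    have gA : g \notin A by apply: contraTN fg; apply: indA.
    rewrite (negPf gA); exists (b f), (a g); rewrite !inE !eqxx /=; split=> //.
    by rewrite adj_sym ab.
  exists (a f), (b g); rewrite !inE !eqxx /=; split=> //; last exact: ab.
  by case: ifP; rewrite !inE eqxx ?orbT.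
Qed.

(** * Rewiring towards a set of hubs *)
Section Rewire.
Variables (G : graph) (L W : {set G}).
Let e : rel G := fun x y => (x != y) &&
  [|| (x \in L) && (y \in L :|: W), (y \in L) && (x \in L :|: W) |
      [&& x \notin W, y \notin W & adj x y]].

Fact rewire_sym : symmetric e.
Proof.
move=> x y; rewrite /e eq_sym adj_sym; congr andb.
rewrite orbCA; congr orb; congr orb; by rewrite andbCA.
Qed.

Fact rewire_irr : irreflexive e.
Proof. by move=> x; rewrite /e eqxx. Qed.

(** The vertices of L form a clique, those of W become twins with neighbourhood L,
    and all other adjacencies are as in G. *)
Definition rewire : graph := Graph rewire_sym rewire_irr.

Lemma adj_rewireE (x y : rewire) : adj x y = (x != y) &&
  [|| (x \in L) && (y \in L :|: W), (y \in L) && (x \in L :|: W) |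
      [&& x \notin W, y \notin W & @adj G x y]].
Proof. by []. Qed.

Hypothesis LW : [disjoint L & W].

Lemma adj_rewire_hub (x y : rewire) :
  x \in L -> adj x y = (x != y) && ((y \in L :|: W) || @adj G x y).
Proof.
move=> xL; have xW := disjointFr LW xL.
rewrite adj_rewireE !in_setU xL xW /=.
by case: (y \in L); case: (y \in W).
Qed.

Lemma adj_rewire_twin (x y : rewire) : x \in W -> adj x y = (y \in L).
Proof.
move=> xW; have xL := disjointFl LW xW.
rewrite adj_rewireE xL !in_setU xW xL /= andbT orbF.
by case: eqP => [<-|]; rewrite ?xL.
Qed.

Lemma adj_rewire_off (x y : rewire) :
  x \notin L -> x \notin W -> adj x y = (y \notin W) && @adj G x y.
Proof.
move=> xL xW; rewrite adj_rewireE !in_setU (negPf xL) (negPf xW) /=.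
by rewrite andbF /=; case: eqP => [->|]; rewrite ?adj_irr ?andbF.
Qed.

(** Why rewiring creates no minors. Given a model in the rewired graph, replace
    each branch set contained in W (necessarily a single vertex) by a private
    vertex of U, and in the others trade the vertices of W for one private vertex
    h l of U for every hub l of the branch set. In G, the vertex h l is adjacent
    to all hubs: it keeps the branch set connected, and it realises every
    adjacency that l owed to a new edge. *)
Lemma rewire_has_model (F : graph) (U : {set G}) :
  U \subset W -> #|F| + #|L| <= #|U| ->
  (forall u l, u \in U -> l \in L -> @adj G u l) ->
  has_model F rewire -> has_model F G.
Proof.
move=> UW cardU UL [phi [p0 pc pd pt]].
have [/card0_eq F0|/card_gt0P [f0 _]] := posnP #|F|.
  exists (fun _ => set0); split=> f; by have := F0 f.
have /set0Pn [g0 _] := p0 f0.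
pose T := [set t : F + G | if t is inr l then l \in L else true].
have [|j jI jU] := @inj_into _ _ g0 T U.
  apply: leq_trans cardU.
  have sT : T \subset (inl @: [set: F]) :|: (inr @: L).
    apply/subsetP=> -[f|l]; rewrite !inE => tT; apply/orP; [left|right];
    by apply/imset_f; rewrite ?inE.
  apply: leq_trans (subset_leq_card sT) _; apply: leq_trans (leq_card_setU _ _) _.
  by rewrite -cardsT; apply: leq_add; apply: leq_imset_card.
pose s f := j (inl f); pose h l := j (inr l).
have sU f : s f \in U by apply: jU; rewrite inE.
have hU l : l \in L -> h l \in U by move=> lL; apply: jU; rewrite inE.
have sI f g : s f = s g -> f = g by move/jI; rewrite !inE => /(_ erefl erefl) [].
have hI l l' : l \in L -> l' \in L -> h l = h l' -> l = l'.
  by move=> lL l'L /jI; rewrite !inE => /(_ lL l'L) [].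
have sh f l : l \in L -> s f = h l -> False.
  by move=> lL /jI; rewrite !inE => /(_ erefl lL).
have UnL u : u \in U -> u \notin L.
  by move/(subsetP UW) => uW; rewrite (disjointFl LW uW).
pose H f := h @: (phi f :&: L).
pose psi f : {set G} := if phi f \subset W then [set s f] else (phi f :\: W) :|: H f.
(* Vertices of W are only adjacent to L, so a branch set that contains one and
   another vertex outside W meets L. *)
have hub f w : w \in phi f -> w \in W -> ~~ (phi f \subset W) -> exists2 l, l \in phi f & l \in L.
  move=> wf wW /subsetPn [x xf xW].
  have wx : w != x by apply: contraNneq xW => <-.
  have [l lf] := connected_set_edge (pc f) wf xf wx.
  by rewrite adj_rewire_twin // => lL; exists l.
exists psi; split.
- move=> f; rewrite /psi; case: ifPn => [_|/subsetPn [x xf xW]].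
    by apply/set0Pn; exists (s f); rewrite inE.
  by apply/set0Pn; exists x; rewrite !inE xW xf.
- move=> f; rewrite /psi; case: ifPn => [_|nsub]; first exact: connected_set1.
  move=> B sB B0 BA; set A := _ :|: _ in sB BA *.
  pose core := (phi f :&: L) :|: H f.
  have coreA : core \subset A.
    apply/subsetP=> x; rewrite !inE => /orP [/andP [xf xL]|->]; last by rewrite orbT.
    by rewrite xf (disjointFr LW xL).
  have Aout x : x \in A -> x \notin core -> [/\ x \in phi f, x \notin L & x \notin W].
    rewrite /A /core !in_setU !in_setI in_setD !negb_or.
    case/orP=> [/andP [xW ->]|->]; rewrite ?andbF //=.
    by case/andP.
  (* Off the hubs and their private neighbours, branch sets and adjacencies are those
     of the given model, so a cut with all of these on one side is crossed. *)
  have step (D : {set G}) : D \subset A -> D != set0 -> [disjoint D & core] -> D != A ->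
      exists x y, [/\ x \in D, y \in A :\: D & @adj G x y].
    move=> sD D0 Dcore DA.
    have Dout x : x \in D -> [/\ x \in phi f, x \notin L & x \notin W].
      by move=> xD; apply: Aout; rewrite ?(subsetP sD) // (disjointFr Dcore xD).
    have [|||x [y [xD yD xy]]] := pc f D => //.
    + by apply/subsetP=> x /Dout [].
    + apply: contra_neq DA => DE; apply/eqP; rewrite eqEsubset sD /= DE.
      have noW x : x \in phi f -> x \notin W by rewrite -DE => /Dout [].
      have noL x : x \in phi f -> x \notin L by rewrite -DE => /Dout [].
      apply/subsetP=> x; rewrite !inE => /orP [/andP [_ ->] //|/imsetP [l]].
      by rewrite inE => /andP [/noL /negPf ->].
    have [xf xL xW] := Dout x xD; move: yD; rewrite in_setD => /andP [yD yf].
    move: xy; rewrite adj_rewire_off // => /andP [yW xy].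
    by exists x, y; rewrite !in_setD !in_setU in_setD yD yW yf.
  have [/eqP BC0|/set0Pn [b]] := boolP (B :&: core == set0).
    by apply: step => //; rewrite -setI_eq0 BC0.
  rewrite in_setI => /andP [bB bc].
  have [Csub|/subsetPn [c cc cB]] := boolP (core \subset B).
    have [|||| y [x [yD + yx]]] := step (A :\: B).
    + exact: finset.subsetDl.
    + rewrite setD_eq0; apply: contra BA => AB; by rewrite eqEsubset sB.
    + rewrite -setI_eq0; apply/eqP/setP=> z; rewrite !in_setI in_setD in_set0.
      by apply/negP=> /andP [/andP [zB _] /(subsetP Csub)]; rewrite (negPf zB).
    + apply/eqP=> E; move: B0; apply/negP; rewrite negbK -subset0.
      apply/subsetP=> z zB; have := subsetP sB z zB; rewrite -E in_setD zB //.
    rewrite !in_setD negb_and negbK => /andP [/orP [xB _|/negP xA /xA //]].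
    by exists x, y; rewrite adj_sym.
  (* Now the cut separates two vertices of core, which spans a complete bipartite
     graph between the hubs of the branch set and their private neighbours. *)
  have [l lf lL] : exists2 l, l \in phi f & l \in L.
    move: bc; rewrite !inE => /orP [/andP [bf bL]|/imsetP [l + _]]; first by exists b.
    by rewrite inE => /andP [lf lL]; exists l.
  have HL x l' : x \in H f -> l' \in L -> @adj G x l'.
    by case/imsetP=> l0; rewrite inE => /andP [_ l0L] -> l'L; apply: UL; auto.
  have hl : h l \in H f by apply/imset_f; rewrite inE lf.
  have toA x : x \in core -> x \notin B -> x \in A :\: B.
    by move=> xc xB; rewrite in_setD xB (subsetP coreA).
  have lc : l \in core by rewrite !inE lf lL.
  have hc : h l \in core by rewrite in_setU hl orbT.
  have inL x : x \in core -> x \notin H f -> x \in L.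
    by rewrite in_setU in_setI => /orP [/andP [] //|->].
  have cross x y : x \in core -> y \in core -> x \in B -> y \notin B ->
      (x \in H f) != (y \in H f) ->
      exists x y, [/\ x \in B, y \in A :\: B & @adj G x y].
    move=> xc yc xB yB; exists x, y; split; rewrite ?toA //.
    have [xH|xH] := boolP (x \in H f).
      by apply: HL => //; apply: inL => //; move: H0; rewrite xH; case: (y \in H f).
    rewrite adj_sym; apply: HL; last exact: inL.
    by move: H0; rewrite (negPf xH); case: (y \in H f).
  have lH : l \notin H f.
    apply/negP=> /imsetP [l0]; rewrite inE => /andP [_ l0L] E.
    by have := UnL _ (hU _ l0L); rewrite -E lL.
  have [bH|bH] := boolP (b \in H f); have [cH|cH] := boolP (c \in H f).
  + have [lB|lB] := boolP (l \in B).
      by apply: (cross l c) => //; rewrite cH (negPf lH).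
    by apply: (cross b l) => //; rewrite bH (negPf lH).
  + by apply: (cross b c) => //; rewrite bH (negPf cH).
  + by apply: (cross b c) => //; rewrite cH (negPf bH).
  + have [lB|lB] := boolP (h l \in B).
      by apply: (cross (h l) c) => //; rewrite hl (negPf cH).
    by apply: (cross b (h l)) => //; rewrite hl (negPf bH).
- have HW f x : x \in H f -> x \in U.
    by case/imsetP=> l; rewrite inE => /andP [_ lL] ->; apply: hU.
  have UW' x : x \in U -> x \notin W -> False by move=> /(subsetP UW) ->.
  move=> f g x; rewrite /psi; case: ifP => fW; case: ifP => gW; rewrite !inE.
  + by move/eqP=> -> /eqP /sI.
  + move/eqP=> -> /orP [/andP [/UW']|/imsetP [l]]; first by case.
    by rewrite inE => /andP [_ lL] /sh; case.
  + move=> xf /eqP xE; move: xf; rewrite xE; case/orP=> [/andP [/UW']|/imsetP [l]]; first by case.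
    by rewrite inE => /andP [_ lL] /sh; case.
  + case/orP=> [/andP [xW xf]|xf]; case/orP=> [/andP [xW' xg]|xg].
    * exact: pd xf xg.
    * by case: (UW' x (HW _ _ xg)).
    * by case: (UW' x (HW _ _ xf)).
    * move: xf xg => /imsetP [l]; rewrite inE => /andP [lf lL] -> /imsetP [l'].
      rewrite inE => /andP [l'g l'L] /hI E; apply: (pd f g l) => //.
      by rewrite E.
- have psi_hub f l : l \in phi f -> l \in L -> l \in psi f.
    move=> lf lL; have lW := disjointFr LW lL.
    rewrite /psi; case: ifP => [/subsetP /(_ l lf)|_]; first by rewrite lW.
    by rewrite !inE lW lf.
  have psi_sub f l y : l \in L -> y \in phi f -> y \in L :|: W -> exists2 u, u \in psi f & u \in U.
    move=> lL yf yLW; rewrite /psi; case: ifPn => [_|nsub].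
      by exists (s f); rewrite ?inE.
    have [l' l'f l'L] : exists2 l', l' \in phi f & l' \in L.
      by move: yLW; rewrite in_setU => /orP [yL|yW]; [exists y|exact: hub yf yW nsub].
    exists (h l'); last exact: hU.
    by rewrite in_setU; apply/orP; right; apply/imset_f; rewrite inE l'f.
  have psi_else f y : y \in phi f -> y \notin W -> y \in psi f.
    move=> yf yW; rewrite /psi; case: ifP => [/subsetP /(_ y yf)|_]; first by rewrite (negPf yW).
    by rewrite !inE yf yW.
  have hub_touch f g x y : x \in phi f -> y \in phi g -> @adj rewire x y -> x \in L ->
      touch (psi f) (psi g).
    move=> xf yg + xL; rewrite adj_rewire_hub // => /andP [_ /orP [yLW|xy]].
      have [u ug uU] := psi_sub g x y xL yg yLW.
      by exists x, u; rewrite psi_hub // adj_sym UL.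
    have [yW|yW] := boolP (y \in W).
      have [|u ug uU] := psi_sub g x y xL yg; first by rewrite in_setU yW orbT.
      by exists x, u; rewrite psi_hub // adj_sym UL.
    by exists x, y; rewrite psi_hub // psi_else.
  move=> f g /pt [x [y [xf yg xy]]].
  have [xL|xL] := boolP (x \in L); first exact: hub_touch xy xL.
  have [yL|yL] := boolP (y \in L).
    have [a [b [? ? ?]]] := hub_touch g f y x yg xf (etrans (adj_sym _ _) xy) yL.
    by exists b, a; rewrite adj_sym.
  have [xW|xW] := boolP (x \in W).
    by move: xy; rewrite adj_rewire_twin // (negPf yL).
  move: xy; rewrite adj_rewire_off // => /andP [yW xy].
  by exists x, y; rewrite !psi_else.
Qed.
End Rewire.

Lemma model_meet_card (F G : graph) (phi : F -> {set G}) (L : {set G}) :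
  is_model phi -> #|[set f | phi f :&: L != set0]| <= #|L|.
Proof.
case=> _ _ pd _; set A := [set f | _].
have [->|/set0Pn [f0]] := eqVneq A set0; first by rewrite cards0.
rewrite inE => /set0Pn [g0 _].
pose rep f := if [pick x in phi f :&: L] is Some x then x else g0.
have repP f : f \in A -> rep f \in phi f :&: L.
  rewrite inE /rep => /set0Pn [x xf]; case: pickP => [//|/(_ x)].
  by rewrite xf.
have repI : {in A &, injective rep}.
  move=> f g /repP + /repP + E; rewrite E !in_setI => /andP [fE _] /andP [gE _].
  exact: pd fE gE.
rewrite -(card_in_imset repI); apply/subset_leq_card/subsetP=> _ /imsetP [f fA ->].
by have := repP f fA; rewrite inE => /andP [].
Qed.

(** Branch sets are disjoint, so at most #|L| of them meet L. *)
Lemma model_avoid (F G : graph) (phi : F -> {set G}) (L : {set G}) :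
  is_model phi -> exists2 Z : {set F}, #|F| <= #|Z| + #|L| &
    forall f x, f \in Z -> x \in phi f -> x \notin L.
Proof.
move=> /(model_meet_card L) le; exists [set f | phi f :&: L == set0].
  rewrite -(cardsC [set f | phi f :&: L == set0]) leq_add2l; apply: leq_trans le.
  by apply/subset_leq_card/subsetP=> f; rewrite !inE.
move=> f x; rewrite inE => /eqP E xf; apply/negP=> xL.
have : x \in phi f :&: L by rewrite inE xf.
by rewrite E inE.
Qed.

Lemma independent_rest_model_free (F G : graph) (L : {set G}) :
  (forall x y, x \notin L -> y \notin L -> ~~ adj x y) ->
  (forall Z : {set F}, #|F| <= #|Z| + #|L| ->
     exists f g, [/\ f \in Z, g \in Z & adj f g]) ->
  ~ has_model F G.
Proof.
move=> indep edge [phi mphi]; have [Z /edge [f [g [fZ gZ fg]]] Zout] := model_avoid L mphi.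
have [x [y [xf yg]]] := model_touch mphi fg.
by move=> xy; have := indep x y (Zout f x fZ xf) (Zout g y gZ yg); rewrite xy.
Qed.

(** If the three branch sets of a path avoid L, the middle one sends edges to two
    different vertices outside it, so it has two vertices and thus an inner edge
    at a vertex that is already matched. *)
Lemma matching_rest_model_free (F G : graph) (L : {set G}) :
  (forall x y z, x \notin L -> y \notin L -> z \notin L ->
     adj x y -> adj x z -> y = z) ->
  (forall Z : {set F}, #|F| <= #|Z| + #|L| ->
     exists f g h, [/\ [/\ f \in Z, g \in Z & h \in Z], f != h, adj g f & adj g h]) ->
  ~ has_model F G.
Proof.
move=> match_rest path [phi mphi].
have [Z /path [f [g [h [[fZ gZ hZ] fh gf gh]]]] Zout] := model_avoid L mphi.
have [x [y [xg yf xy]]] := model_touch mphi gf.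
have [x' [z [x'g zh x'z]]] := model_touch mphi gh.
have disj := model_disjoint mphi.
have [xx'|xx'] := eqVneq x x'.
  have yz : y = z by apply: (match_rest x) => //;
    [exact: Zout gZ xg|exact: Zout fZ yf|exact: Zout hZ zh|rewrite xx'].
  by move: fh; rewrite (disj f h y) ?eqxx // yz.
have [w wg xw] := connected_set_edge (model_connected mphi (f := g)) xg x'g xx'.
have yw : y = w by apply: (match_rest x) => //;
    [exact: Zout gZ xg|exact: Zout fZ yf|exact: Zout gZ wg].
by have := adj_neq gf; rewrite (disj f g y) ?eqxx // yw.
Qed.

(** * The Perron vector and the Rayleigh quotient *)
Section QuadraticForm.
Local Open Scope ring_scope.
Variables (R : realType) (T : finType) (a : T -> T -> R).

Definition bform (x y : T -> R) : R := \sum_s \sum_t a s t * x s * y t.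
Definition sqnorm (x : T -> R) : R := \sum_t x t ^+ 2.

Lemma sqnorm_ge0 x : 0 <= sqnorm x.
Proof. by apply: sumr_ge0 => t _; apply: sqr_ge0. Qed.

Lemma sqnorm_eq0 x : sqnorm x = 0 -> forall t, x t = 0.
Proof.
move=> /eqP; rewrite psumr_eq0 => [/allP x0 t|t _]; last exact: sqr_ge0.
by have := x0 t (mem_index_enum t); rewrite sqrf_eq0 => /eqP.
Qed.

Lemma bform_scale c x : bform (fun t => c * x t) (fun t => c * x t) = c ^+ 2 * bform x x.
Proof.
rewrite /bform mulr_sumr; apply: eq_bigr => s _; rewrite mulr_sumr.
by apply: eq_bigr => t _; ring.
Qed.

Lemma sqnorm_scale c x : sqnorm (fun t => c * x t) = c ^+ 2 * sqnorm x.
Proof. by rewrite /sqnorm mulr_sumr; apply: eq_bigr => s _; ring. Qed.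

Local Open Scope classical_set_scope.

(** The quotient is maximised on the compact unit sphere, and homogeneity extends
    the bound to all vectors. *)
Lemma bform_max (t0 : T) : exists2 x, sqnorm x = 1 &
  forall y, bform y y <= bform x x * sqnorm y.
Proof.
pose n := #|T|.
pose row_fun (u : 'rV[R]_n) t := u ord0 (enum_rank t).
pose fun_row (x : T -> R) : 'rV[R]_n := \row_i x (enum_val i).
have fun_rowK x : row_fun (fun_row x) = x.
  by apply: funext => t; rewrite /row_fun mxE enum_rankK.
pose box := [set u : 'rV[R]_n | forall i, `[(-1 : R), 1] (u ord0 i)].
pose sphere := [set u : 'rV[R]_n | sqnorm (row_fun u) = 1].
have cont_coord t : continuous (fun u : 'rV[R]_n => row_fun u t : R).
  by move=> u; apply: coord_continuous.
have cont_mul (f g : 'rV[R]_n -> R) : continuous f -> continuous g ->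
    continuous (fun u => f u * g u).
  by move=> cf cg u; apply: (continuousM (cf u) (cg u)).
have cont_sum (f : T -> 'rV[R]_n -> R) : (forall t, continuous (f t)) ->
    continuous (fun u => \sum_t f t u).
  by move=> cf; apply: continuous_big => // ; exact: add_continuous.
have csphere : closed sphere.
  apply: (@closed_comp _ _ (fun u : 'rV[R]_n => sqnorm (row_fun u)) [set (1 : R)]);
    last exact: closed_eq.
  move=> u _; apply: cont_sum => t.
  by apply: (cont_mul); apply: (cont_coord).
have sphere_box u : sphere u -> box u.
  move=> u1 i; rewrite /= in_itv /= -ler_norml.
  rewrite -(@expr_le1 _ 2) // real_normK ?num_real // -u1 /sqnorm.
  rewrite (bigD1 (enum_val i)) //= /row_fun enum_valK lerDl.
  by apply: sumr_ge0 => t _; apply: sqr_ge0.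
have compact_sphere : compact sphere.
  apply: (subclosed_compact csphere _ sphere_box).
  apply: (@rV_compact R n (fun=> `[(-1 : R), 1])) => _; exact: segment_compact.
have [|||u uS umax] := @compact_EVT_max _ R
  (fun u : 'rV[R]_n => bform (row_fun u) (row_fun u)) sphere.
- exists (fun_row (fun t => (t == t0)%:R)); rewrite /sphere /= fun_rowK /sqnorm.
  rewrite (bigD1 t0) //= eqxx expr1n big1 ?addr0 // => t /negPf ->.
  by rewrite expr0n.
- exact: compact_sphere.
- apply: continuous_subspaceT.
  apply: (cont_sum) => s; apply: cont_sum => t.
  apply: (cont_mul); last exact: (cont_coord).
  by apply: cont_mul; [exact: cst_continuous|exact: cont_coord].
exists (row_fun u) => [|y]; first exact: set_mem uS.
have [y0|y0] := eqVneq (sqnorm y) 0.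
  rewrite y0 mulr0 [bform y y]big1 // => s _; rewrite big1 // => t _.
  by rewrite (sqnorm_eq0 y0) mulr0 mul0r.
have ygt0 : 0 < sqnorm y by rewrite lt_neqAle eq_sym y0 sqnorm_ge0.
pose c := (Num.sqrt (sqnorm y))^-1.
have c2 : c ^+ 2 = (sqnorm y)^-1 by rewrite exprVn sqr_sqrtr ?ltW.
have := umax (fun_row (fun t => c * y t)).
rewrite fun_rowK bform_scale c2 => /(_ (mem_set _)) le.
have {}le : (sqnorm y)^-1 * bform y y <= bform (row_fun u) (row_fun u).
  by apply: le; rewrite /sphere /= fun_rowK sqnorm_scale c2 mulVf.
move: le.
by rewrite mulrC ler_pdivrMr.
Qed.

Local Close Scope classical_set_scope.

Hypothesis a_sym : forall s t, a s t = a t s.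
Hypothesis a_ge0 : forall s t, 0 <= a s t.

Lemma bformDr x y z : bform x (fun t => y t + z t) = bform x y + bform x z.
Proof.
rewrite /bform -big_split; apply: eq_bigr => s _ /=; rewrite -big_split.
by apply: eq_bigr => t _ /=; rewrite mulrDr.
Qed.

Lemma bformC x y : bform x y = bform y x.
Proof.
rewrite /bform exchange_big; apply: eq_bigr => s _; apply: eq_bigr => t _.
by rewrite a_sym; ring.
Qed.

Lemma bformZr x c y : bform x (fun t => c * y t) = c * bform x y.
Proof.
rewrite /bform mulr_sumr; apply: eq_bigr => s _; rewrite mulr_sumr.
by apply: eq_bigr => t _; ring.
Qed.

Lemma bform_delta x s : bform (fun t => (t == s)%:R) x = \sum_t a s t * x t.
Proof.
rewrite /bform (bigD1 s) //= [X in _ + X]big1 ?addr0 => [|i /negPf ->].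
  by apply: eq_bigr => t _; rewrite eqxx mulr1.
by rewrite big1 // => t _; rewrite mulr0 mul0r.
Qed.

(** Vanishing of the first variation along the coordinate s. *)
Lemma bform_max_eigen mu z : sqnorm z = 1 -> bform z z = mu ->
  (forall y, bform y y <= mu * sqnorm y) ->
  forall s, \sum_t a s t * z t = mu * z s.
Proof.
move=> z1 zmu zmax s; apply/eqP; rewrite -subr_eq0; set c := _ - _.
pose e t : R := (t == s)%:R; pose M := mu - bform e e.
have key k : k * (2 * c) <= k ^+ 2 * M.
  pose y t := z t + k * e t.
  have Qy : bform y y = mu + 2 * k * bform e z + k ^+ 2 * bform e e.
    rewrite /y bformDr bformZr ![bform (fun t => _ + _) _]bformC !bformDr !bformZr.
    by rewrite zmu [bform z e]bformC; ring.
  have Ny : sqnorm y = 1 + 2 * k * z s + k ^+ 2.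
    have -> : sqnorm y = sqnorm z + 2 * k * (\sum_t z t * e t) + k ^+ 2 * \sum_t e t ^+ 2.
      rewrite /sqnorm !mulr_sumr -!big_split; apply: eq_bigr => t _ /=.
      by rewrite /y; ring.
    have -> : \sum_t z t * e t = z s.
      rewrite (bigD1 s) //= big1 => [|t /negPf E]; last by rewrite /e E mulr0.
      by rewrite /e eqxx mulr1 addr0.
    have -> : \sum_t e t ^+ 2 = 1.
      rewrite (bigD1 s) //= big1 => [|t /negPf E]; last by rewrite /e E expr0n.
      by rewrite /e eqxx expr1n addr0.
    by rewrite z1 mulr1.
  have := zmax y; rewrite Qy Ny bform_delta -subr_ge0 => le.
  rewrite -subr_ge0 /M /c; apply: le_trans le _; rewrite le_eqVlt; apply/orP; left.
  by apply/eqP; ring.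
apply/negPn/negP => c0.
(* The step c / K is short enough for the linear gain to beat the quadratic
   term. *)
pose K := `|M| + 1.
have K0 : 0 < K by rewrite ltr_pwDr.
have := key (c / K); rewrite -subr_ge0.
have -> : (c / K) ^+ 2 * M - c / K * (2 * c) = (c / K) ^+ 2 * (M - 2 * K).
  by field; rewrite gt_eqF.
rewrite pmulr_rge0; last by rewrite exprn_even_gt0 //= mulf_neq0 // invr_eq0 gt_eqF.
rewrite leNgt /K; have := ler_norm M; have := normr_ge0 M; lra.
Qed.

Lemma bform_norm_le x : bform x x <= bform (fun t => `|x t|) (fun t => `|x t|).
Proof.
apply: ler_sum => s _; apply: ler_sum => t _; rewrite -!mulrA ler_wpM2l //.
by rewrite -normrM ler_norm.
Qed.

(** Taking absolute values does not decrease the form, since the coefficients are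
    nonnegative. *)
Lemma bform_perron (t0 : T) : exists mu z,
  [/\ forall t, 0 <= z t, sqnorm z = 1, forall s, \sum_t a s t * z t = mu * z s
    & forall y, bform y y <= mu * sqnorm y].
Proof.
have [x x1 xmax] := bform_max t0; pose z t := `|x t|.
have z1 : sqnorm z = 1.
  by rewrite -x1; apply: eq_bigr => t _; rewrite real_normK ?num_real.
have zmu : bform z z = bform x x.
  apply/eqP; rewrite eq_le bform_norm_le andbT.
  by have := xmax z; rewrite z1 mulr1.
exists (bform x x), z; split=> //; first by move=> t; apply: normr_ge0.
exact: bform_max_eigen.
Qed.

End QuadraticForm.

Section SpectralRadius.
Local Open Scope ring_scope.
Variables (R : realType) (G : graph).

Let a (x y : G) : R := (adj x y)%:R.

Lemma sum_adj (x : G) (f : G -> R) : \sum_y a x y * f y = \sum_(y | adj x y) f y.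
Proof.
by rewrite [RHS]big_mkcond; apply: eq_bigr => y _; rewrite /a; case: adj; rewrite ?mul1r ?mul0r.
Qed.

(** Eigenvectors as functions on the vertices, free of the enumeration that indexes
    the adjacency matrix. *)
Lemma eigenvalueE mu : eigenvalue (adjacency_mx R G) mu <->
  exists2 x : G -> R, (exists v, x v != 0) & forall v, \sum_(w | adj v w) x w = mu * x v.
Proof.
have mulE (u : 'rV[R]_#|G|) j : (u *m adjacency_mx R G) 0 j =
    \sum_(w | adj (enum_val j) w) u 0 (enum_rank w).
  rewrite mxE -(sum_adj _ (fun w => u 0 (enum_rank w))).
  rewrite (reindex _ (onW_bij _ (@enum_val_bij G))) /=; apply: eq_bigr => i _.
  by rewrite mxE enum_valK mulrC /a adj_sym.
split=> [/eigenvalueP [u uE u0]|[x [v xv] xE]].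
  exists (fun w => u 0 (enum_rank w)).
    have [i ui] : exists i, u 0 i != 0.
      apply/existsP; apply: contraNT u0; rewrite negb_exists => /forallP u0.
      by apply/eqP/rowP => i; rewrite mxE; apply/eqP; have := u0 i; rewrite negbK.
    by exists (enum_val i); rewrite enum_valK.
  by move=> w; rewrite -{1}(enum_rankK w) -mulE uE mxE.
apply/eigenvalueP; exists (\row_i x (enum_val i)).
  apply/rowP=> j; rewrite mulE !mxE -xE; apply: eq_bigr => w _.
  by rewrite mxE enum_rankK.
apply: contra_neq xv => /rowP /(_ (enum_rank v)); by rewrite !mxE enum_rankK.
Qed.

Let radius := spectral_radius R G.

(** The maximum of the Rayleigh quotient is an eigenvalue, and it bounds all
    eigenvalues. *)
Lemma spectral_perron : (0 < #|G|)%N ->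
  exists z : G -> R, [/\ forall v, 0 <= z v, exists v, z v != 0,
    forall v, \sum_(w | adj v w) z w = radius * z v
  & forall y : G -> R, \sum_v \sum_(w | adj v w) y v * y w <= radius * \sum_v y v ^+ 2].
Proof.
move=> /card_gt0P [t0 _].
have a_sym s t : a s t = a t s by rewrite /a adj_sym.
have a_ge0 s t : 0 <= a s t by apply: ler0n.
have bformE (y : G -> R) : bform a y y = \sum_v \sum_(w | adj v w) y v * y w.
  apply: eq_bigr => v _; rewrite -(sum_adj _ (fun w => y v * y w)).
  by apply: eq_bigr => w _; rewrite mulrA.
have [mu [z [z0 z1 zE zmax]]] := bform_perron a_sym a_ge0 t0.
have znz : exists v, z v != 0.
  apply: contrapT => zz; have : sqnorm z = 0.
    rewrite /sqnorm big1 // => t _; have [-> |zt] := eqVneq (z t) 0; first by rewrite expr0n.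
    by case: zz; exists t.
  by rewrite z1 => /eqP; rewrite oner_eq0.
have {}zE v : \sum_(w | adj v w) z w = mu * z v by rewrite -sum_adj.
suff muE : radius = mu.
  by exists z; split; rewrite ?muE // => y; rewrite -bformE.
have mu_eig : eigenvalue (adjacency_mx R G) mu by apply/eigenvalueE; exists z.
have ub : forall b, eigenvalue (adjacency_mx R G) b -> b <= mu.
  move=> b /eigenvalueE [x [v xv] xE].
  have := zmax x; rewrite bformE.
  have -> : \sum_v \sum_(w | adj v w) x v * x w = b * sqnorm x.
    rewrite /sqnorm mulr_sumr; apply: eq_bigr => w _; rewrite -mulr_sumr xE.
    by ring.
  rewrite ler_pM2r // lt_neqAle sqnorm_ge0 andbT eq_sym.
  by apply: contra_neq xv => /sqnorm_eq0; apply.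
apply/eqP; rewrite eq_le /radius /spectral_radius; apply/andP; split.
  by apply: sup_le_ub; [exists mu|].
by apply: ub_le_sup; [exists mu|].
Qed.

End SpectralRadius.

(** * Locating the hubs *)
Lemma exists_subset_card (T : finType) (A : {set T}) k : k <= #|A| ->
  exists2 B : {set T}, B \subset A & #|B| = k.
Proof.
case/card_geqP=> s [us <- sA]; exists [set x in s]; last first.
  by rewrite cardsE; apply/card_uniqP.
by apply/subsetP=> x; rewrite inE; apply: sA.
Qed.

(** Here z is the Perron vector with maximum 1 and lam the spectral radius; g is
    the number of hubs, C bounds the density, and K_{g+1,q} is excluded. *)
Section Weights.
Local Open Scope ring_scope.
Variables (R : realType) (G : graph) (z : G -> R) (lam : R) (g q C : nat).

Let n : R := #|G|%:R.
Let deg (v : G) : R := #|nbr v|%:R.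

Hypothesis g_gt0 : (0 < g)%N.
Hypothesis C_gt0 : (0 < C)%N.
Hypothesis sparse : forall A : {set G},
  (\sum_(x in A) #|nbr x :&: A| <= C * #|A|)%N.
Hypothesis no_biclique : forall X Y : {set G}, #|X| = g.+1 -> (q <= #|Y|)%N ->
  [disjoint X & Y] -> (forall x y, x \in X -> y \in Y -> adj x y) -> False.
Hypothesis z_ge0 : forall v, 0 <= z v.
Hypothesis z_le1 : forall v, z v <= 1.
Hypothesis z_eigen : forall v, \sum_(w | adj v w) z w = lam * z v.
Hypothesis lam_gt0 : 0 < lam.
Hypothesis lam_sq : g%:R * (n - g%:R) <= lam ^+ 2.

Lemma degE v : deg v = \sum_(w | adj v w) 1.
Proof. by rewrite sumr_const /deg; congr (_%:R); apply: eq_card => w; rewrite inE. Qed.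

Lemma deg_ge0 v : 0 <= deg v. Proof. exact: ler0n. Qed.

Lemma sum_le_card (P : pred G) (A : {set G}) (c : R) : 0 <= c ->
  (forall w, P w -> w \in A) -> (forall w, P w -> z w <= c) ->
  \sum_(w | P w) z w <= c * #|A|%:R.
Proof.
move=> c0 PA Pc; apply: le_trans (ler_sum _ Pc) _.
rewrite sumr_const mulr_natr ler_wpMn2l //.
by apply/subset_leq_card/subsetP=> w; apply: PA.
Qed.

Lemma lam_le_deg v : lam * z v <= deg v.
Proof. by rewrite -z_eigen degE; apply: ler_sum => w _. Qed.

Lemma sum_deg_le : \sum_v deg v <= C%:R * n.
Proof.
rewrite -natr_sum -natrM ler_nat -cardsT.
apply: leq_trans (sparse [set: G]).
by rewrite big_mkcond [leqRHS]big_mkcond; apply: leq_sum => v _; rewrite inE setIT.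
Qed.

(** The eigenvalue equation applied twice: walks of length two. *)
Lemma two_step v : lam ^+ 2 * z v = \sum_(u | adj v u) \sum_(w | adj u w) z w.
Proof.
rewrite expr2 -mulrA -z_eigen mulr_sumr; apply: eq_bigr => u _.
by rewrite z_eigen.
Qed.

Section Threshold.
Variables (S : {set G}) (eps : R).
Hypothesis eps_ge0 : 0 <= eps.
Hypothesis z_off : forall w, w \notin S -> z w <= eps.

Definition nbr_weight (u : G) : R := \sum_(w | adj u w && (w \in S)) z w.

Lemma nbr_weight_le u : nbr_weight u <= #|nbr u :&: S|%:R.
Proof.
rewrite -[leRHS]mul1r; apply: sum_le_card => // w; by rewrite !inE.
Qed.

(** Walks that end outside S contribute at most eps for each arc of G. *)
Lemma two_step_le v : lam ^+ 2 * z v <= eps * (C%:R * n) + \sum_(u | adj v u) nbr_weight u.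
Proof.
rewrite two_step.
have -> : \sum_(u | adj v u) \sum_(w | adj u w) z w =
   \sum_(u | adj v u) \sum_(w | adj u w && (w \notin S)) z w + \sum_(u | adj v u) nbr_weight u.
  rewrite -big_split; apply: eq_bigr => u _ /=.
  by rewrite (bigID (mem S)) /= addrC.
rewrite lerD2r; apply: le_trans (_ : eps * \sum_u deg u <= _); last first.
  by rewrite ler_wpM2l // sum_deg_le.
rewrite mulr_sumr big_mkcond; apply: ler_sum => u _; case: ifP => _; last first.
  by rewrite mulr_ge0 ?deg_ge0.
apply: sum_le_card => // w /andP []; rewrite ?inE //; by move=> _; apply: z_off.
Qed.

(** The walks that end in S use edges inside the union of S and the neighbourhood
    of v, where the density bound applies. *)
Lemma sum_nbr_weight_le v : \sum_(u | adj v u) nbr_weight u <= C%:R * (deg v + #|S|%:R).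
Proof.
pose A := nbr v :|: S.
apply: le_trans (_ : (\sum_(u in A) #|nbr u :&: A|)%:R <= _).
  rewrite natr_sum big_mkcond [leRHS]big_mkcond; apply: ler_sum => u _.
  case: ifP => vu; last by case: ifP.
  rewrite !inE vu; apply: le_trans (nbr_weight_le u) _; rewrite ler_nat.
  by apply/subset_leq_card/setIS/finset.subsetUr.
apply: le_trans (_ : (C * #|A|)%:R <= _); first by rewrite ler_nat sparse.
rewrite natrM ler_wpM2l // /deg -natrD ler_nat; exact: leq_card_setU.
Qed.

End Threshold.

Lemma heavy_markov (A : {set G}) (c : R) : (forall v, v \in A -> c <= deg v) ->
  #|A|%:R * c <= C%:R * n.
Proof.
move=> cA; apply: le_trans sum_deg_le; rewrite mulr_natl -sumr_const.
by rewrite big_mkcond; apply: ler_sum => v _; case: ifP => [/cA|_] //; rewrite deg_ge0.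
Qed.

Hypothesis n_ge : g.*2%:R <= n.

Lemma lam_sq_half : n / 2 <= lam ^+ 2.
Proof.
apply: le_trans lam_sq; have : 1 <= g%:R :> R by rewrite ler1n.
move: n_ge; rewrite -muln2 natrM; move: (n) (g%:R : R) => a b; nra.
Qed.

Let heavy (c : R) : {set G} := [set v | c < z v].

Lemma z_heavy c w : w \notin heavy c -> z w <= c.
Proof. by rewrite inE -leNgt. Qed.

(** By the first-order bound lam * z v <= deg v, the vertices of weight above
    eps, a small multiple of delta, number at most eps * n for large n. For
    v of weight above delta the two-step expansion then forces deg v to be linear
    in n, and the number of vertices of linear degree is bounded. *)
Lemma heavy_bounded (delta : R) : 0 < delta ->
  ((64 * C%:R ^+ 3) / delta ^+ 2) ^+ 2 <= n / 2 ->
  #|heavy delta|%:R <= 4 * C%:R ^+ 2 / delta.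
Proof.
move=> d0 nbig; have C0 : 0 < C%:R :> R by rewrite ltr0n.
pose eps := delta / (8 * C%:R).
have eps0 : 0 < eps by rewrite divr_gt0 ?mulr_gt0.
have n0 : 0 < n by apply: lt_le_trans n_ge; rewrite ltr0n double_gt0.
have lamC : C%:R / eps ^+ 2 <= lam.
  have le0 : 0 <= C%:R / eps ^+ 2 by rewrite divr_ge0 ?exprn_ge0 ?ltW.
  rewrite -(@ler_pXn2r _ 2) ?nnegrE ?le0 ?(ltW lam_gt0) //.
  apply: le_trans lam_sq_half; apply: le_trans nbig.
  have -> // : C%:R / eps ^+ 2 = 64 * C%:R ^+ 3 / delta ^+ 2.
  by rewrite /eps; field; rewrite !gt_eqF.
have few : #|heavy eps|%:R <= eps * n.
  have := @heavy_markov (heavy eps) (lam * eps) _.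
  have h v : v \in heavy eps -> lam * eps <= deg v.
    rewrite inE => zv; apply: le_trans (lam_le_deg v).
    by rewrite ler_wpM2l ?ltW.
  move=> /(_ h) le; have : #|heavy eps|%:R * (C%:R / eps) <= C%:R * n.
    apply: le_trans le; rewrite ler_wpM2l // -ler_pdivrMr //.
    by rewrite -mulrA -invfM -expr2.
  move=> le'.
  have -> : eps * n = C%:R * n * (eps / C%:R) by field; rewrite gt_eqF.
  rewrite -[leLHS](_ : #|heavy eps|%:R * (C%:R / eps) * (eps / C%:R) = _).
    by rewrite ler_wpM2r // divr_ge0 ?ltW.
  by field; rewrite !gt_eqF.
have big_deg v : v \in heavy delta -> delta * n / (4 * C%:R) <= deg v.
  rewrite inE => zv.
  have := two_step_le (ltW eps0) (@z_heavy eps) v.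
  have := sum_nbr_weight_le (heavy eps) v.
  have l2 := lam_sq_half.
  have : delta * (n / 2) <= lam ^+ 2 * z v.
    by rewrite mulrC; apply: ler_pM => //; rewrite ?divr_ge0 //; apply: ltW.
  move=> h1 h2 h3; rewrite ler_pdivrMr ?mulr_gt0 //.
  have e8 : eps * (8 * C%:R) = delta by rewrite /eps divfK // gt_eqF ?mulr_gt0.
  have : C%:R * #|heavy eps|%:R <= C%:R * (eps * n) by rewrite ler_wpM2l.
  move: h1 h2 h3; rewrite mulrDr -e8; lra.
have := @heavy_markov (heavy delta) _ big_deg.
rewrite ler_pdivlMr // => le.
have : #|heavy delta|%:R * delta * n <= 4 * C%:R ^+ 2 * n.
  have -> : #|heavy delta|%:R * delta * n =
     #|heavy delta|%:R * (delta * n / (4 * C%:R)) * (4 * C%:R).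
    by field; rewrite gt_eqF.
  have -> : 4 * C%:R ^+ 2 * n = C%:R * n * (4 * C%:R) by ring.
  by apply: ler_wpM2r => //; rewrite mulr_ge0.
by rewrite ler_pM2r.
Qed.

(** Vertices outside S with the same trace on S, of more than g vertices, number
    less than q, and there are at most 2^K traces. *)
Lemma crowded_bounded (S : {set G}) K : (#|S| <= K)%N ->
  (#|[set u | g < #|nbr u :&: S|]| <= K + 2 ^ K * q)%N.
Proof.
move=> SK; set X := [set u | _].
rewrite -(cardsID S X); apply: leq_add.
  by apply: leq_trans SK; apply/subset_leq_card/finset.subsetIr.
apply: (@leq_trans (2 ^ #|S| * q)); last by rewrite leq_mul2r leq_exp2l ?SK ?orbT.
rewrite -card_powerset -sum_nat_const -sum1_card.
rewrite (partition_big (fun u => nbr u :&: S) (mem (powerset S))) /=; last first.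
  by move=> u _; rewrite powersetE finset.subsetIr.
apply: leq_sum => Y _; rewrite sum1dep_card; set P := [set u | _].
have [/ltnW //|big] := ltnP #|P| q.
have [->//|/card_gt0P [u]] := posnP #|P|.
rewrite inE in_setD inE => /andP [/andP [uS ug] /eqP uY]; rewrite uY in ug.
have [Z ZY cardZ] := exists_subset_card ug.
have mP x : x \in P -> x \notin S /\ nbr x :&: S = Y.
  by rewrite inE in_setD => /andP [/andP [? _] /eqP].
case: (@no_biclique Z P) => // [|x y xZ /mP [_ yY]].
  rewrite -setI_eq0; apply/eqP/setP=> x; rewrite in_setI in_set0.
  apply/negP=> /andP [/(subsetP ZY) xY /mP [xS _]].
  by rewrite -uY in_setI (negPf xS) andbF in xY.
by have := subsetP ZY x xZ; rewrite -yY !inE adj_sym => /andP [].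
Qed.

(** From here on delta is a small threshold, S the bounded set of vertices above
    it, and the few vertices that see more than g vertices of S are crowded; M0
    bounds their total contribution. The order n is large with respect to all
    of these. *)
Section Structure.
Variables (eta delta : R) (K m : nat).
Let S := heavy delta.
Let crowded : {set G} := [set u | (g < #|nbr u :&: S|)%N].
Let M0 : R := K%:R * (K + 2 ^ K * q)%:R.
Hypotheses (eta0 : 0 < eta) (eta_half : eta <= 1 / 2) (g_eta : 4 * g%:R * eta <= 1).
Hypotheses (delta0 : 0 < delta) (delta_C : delta * C%:R <= eta / 2).
Hypothesis SK : (#|S| <= K)%N.
Hypothesis n_big : M0 + g%:R ^+ 2 + g%:R * q%:R < eta / 2 * n.
Hypothesis n_m : m%:R <= n / 4.

Lemma order_gt0 : 0 < n.
Proof. by apply: lt_le_trans n_ge; rewrite ltr0n double_gt0. Qed.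

Lemma two_step_uncrowded v : lam ^+ 2 * z v <=
  delta * (C%:R * n) + \sum_(u | adj v u && (u \notin crowded)) nbr_weight S u + M0.
Proof.
apply: le_trans (two_step_le (ltW delta0) (@z_heavy delta) v) _.
rewrite -addrA lerD2l (bigID (mem crowded)) /= addrC lerD2l.
apply: le_trans (_ : \sum_(u in crowded) K%:R <= _).
  rewrite big_mkcond [leRHS]big_mkcond; apply: ler_sum => u _ /=.
  case: (u \in crowded); rewrite ?andbF // andbT; case: ifP => // _.
  apply: le_trans (nbr_weight_le S u) _; rewrite ler_nat; apply: leq_trans SK.
  exact/subset_leq_card/finset.subsetIr.
rewrite sumr_const -[leLHS]mulr_natr /M0 ler_wpM2l // ler_nat; exact: crowded_bounded.
Qed.

Lemma nbr_weight_uncrowded u : u \notin crowded -> nbr_weight S u <= g%:R.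
Proof.
rewrite inE -leqNgt => ug; apply: le_trans (nbr_weight_le S u) _; by rewrite ler_nat.
Qed.

Lemma two_step_deg v :
  lam ^+ 2 * z v <= delta * (C%:R * n) + g%:R * deg v + M0.
Proof.
apply: le_trans (two_step_uncrowded v) _; rewrite lerD2r lerD2l.
rewrite degE mulr_sumr big_mkcond [leRHS]big_mkcond; apply: ler_sum => u _.
case: (adj v u) => //=; rewrite mulr1; case: ifP => // /nbr_weight_uncrowded //.
Qed.

(** At a vertex of weight 1 the expansion sums nbr_weight S u <= g over at most n
    uncrowded vertices u, up to lower order terms, and reaches g (n - g). So some
    u attains almost g; its neighbours in S are the hubs. *)
Lemma hubs_exist : (exists v, z v = 1) ->
  exists2 L : {set G}, #|L| = g & forall l, l \in L -> 1 - eta <= z l.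
Proof.
move=> [v z1].
have [/existsP [u /andP [uX hu]]|none] :=
    boolP [exists u, (u \notin crowded) && (g%:R - eta <= nbr_weight S u)].
  have hu' := nbr_weight_le S u; have : (#|nbr u :&: S| <= g)%N by move: uX; rewrite inE -leqNgt.
  rewrite leq_eqVlt => /orP [/eqP cardL|lt]; last first.
    have : #|nbr u :&: S|%:R + 1 <= g%:R :> R by rewrite natr1 ler_nat.
    by move: eta_half; lra.
  exists (nbr u :&: S) => // l lL.
  have : nbr_weight S u <= #|(nbr u :&: S) :\ l|%:R + z l.
    rewrite /nbr_weight (bigD1 l) /=; last by move: lL; rewrite !inE.
    rewrite addrC lerD2r -[leRHS]mul1r; apply: sum_le_card => // w.
    by rewrite !inE => /andP [/andP [-> ->] ->].
  have : #|nbr u :&: S|%:R = 1 + #|(nbr u :&: S) :\ l|%:R :> R.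
    by rewrite (cardsD1 l) lL natrD.
  by rewrite cardL; lra.
have := two_step_uncrowded v; rewrite z1 mulr1 => le; have le' := le_trans lam_sq le.
have : \sum_(u | adj v u && (u \notin crowded)) nbr_weight S u <= (g%:R - eta) * n.
  apply: le_trans (_ : \sum_(u : G) (g%:R - eta) <= _); last first.
    by rewrite sumr_const mulr_natr.
  have ge0 : 0 <= g%:R - eta by have : 1 <= g%:R :> R; [rewrite ler1n|move: eta_half; lra].
  rewrite big_mkcond; apply: ler_sum => u _; case: ifP => // /andP [_ uX].
  move: none; rewrite negb_exists => /forallP /(_ u); rewrite uX /= -ltNge; exact: ltW.
have : delta * C%:R * n <= eta / 2 * n by rewrite ler_wpM2r // ltW // order_gt0.
have : 0 <= g%:R * q%:R :> R by rewrite mulr_ge0.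
move: le' n_big; rewrite mulrA; move: (delta * C%:R * n) (\sum_(u | _) _) => a b; lra.
Qed.

Section Hubs.
Variable L : {set G}.
Hypotheses (cardL : #|L| = g) (zL : forall l, l \in L -> 1 - eta <= z l).

Definition common_nbrs : {set G} := [set u | [forall l in L, adj u l]].
Let B := common_nbrs.

Lemma common_nbrsP u : reflect (forall l, l \in L -> adj u l) (u \in B).
Proof. by rewrite inE; apply: forall_inP. Qed.

Lemma common_nbrs_notin u : u \in B -> u \notin L.
Proof. by move/common_nbrsP => uB; apply/negP=> /uB; rewrite adj_irr. Qed.

(** A hub has weight almost 1, so the two-step bound leaves little room below n for
    its degree. *)
Lemma hub_deg l : l \in L -> n - deg l <= 2 * eta * n.
Proof.
move=> lL; have g1 : 1 <= g%:R :> R by rewrite ler1n.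
have gq : 0 <= g%:R * q%:R :> R by rewrite mulr_ge0.
have dC : delta * C%:R * n <= eta / 2 * n by rewrite ler_wpM2r // ltW // order_gt0.
have := two_step_deg l; rewrite mulrA => h.
have ng : 0 <= n - g%:R.
  rewrite subr_ge0; apply: le_trans n_ge; rewrite ler_nat -addnn; exact: leq_addr.
have h2 : g%:R * (n - g%:R) * (1 - eta) <= lam ^+ 2 * z l.
  by apply: ler_pM; rewrite ?mulr_ge0 ?zL // subr_ge0; apply: le_trans eta_half _; lra.
have e : 0 <= g%:R ^+ 2 * eta by rewrite mulr_ge0 ?exprn_ge0 // ltW.
have h3 : g%:R * (n - deg l) <= g%:R * (2 * eta * n).
  have : 0 <= (g%:R - 1) * (eta * n).
    by rewrite mulr_ge0 ?subr_ge0 // mulr_ge0 ?ltW // order_gt0.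
  have E : g%:R * (n - g%:R) * (1 - eta) =
     g%:R * n - g%:R * (eta * n) - g%:R ^+ 2 + g%:R ^+ 2 * eta by ring.
  have := n_big; rewrite {}E in h2; move: h h2 dC; rewrite !mulrBr; lra.
by rewrite ler_pM2l // in h3; apply: lt_le_trans g1.
Qed.

Lemma card_not_common : #|~: B|%:R <= 2 * g%:R * eta * n.
Proof.
have : (#|~: B| <= \sum_(l in L) #|~: nbr l|)%N.
  rewrite -sum1_card; apply: (@leq_trans (\sum_(u in ~: B) \sum_(l in L) ~~ adj l u)).
    apply: leq_sum => u; rewrite inE => uB.
    have [l lL lu] : exists2 l, l \in L & ~~ adj l u.
      move: uB; rewrite inE negb_forall => /existsP [l]; rewrite negb_imply => /andP [lL].
      by rewrite adj_sym; exists l.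
    by rewrite (bigD1 l) //= lu.
  rewrite exchange_big; apply: leq_sum => l _; rewrite -sum1_card big_mkcond [leqRHS]big_mkcond.
  by apply: leq_sum => u _; rewrite !inE; case: (adj l u); case: ifP.
rewrite -(ler_nat R) => h; apply: le_trans h _; rewrite natr_sum.
have -> : 2 * g%:R * eta * n = \sum_(l in L) 2 * eta * n.
  by rewrite sumr_const cardL -mulr_natr; ring.
apply: ler_sum => l /hub_deg; apply: le_trans.
by rewrite cardsCs finset.setCK natrB ?max_card.
Qed.

Let eps := 2 * eta * (1 + 2 * g%:R ^+ 2).

(** Otherwise w together with L spans a K_{g+1,q}. *)
Lemma off_hub_common w : w \notin L -> (#|nbr w :&: B| < q)%N.
Proof.
move=> wL; rewrite ltnNge; apply/negP=> big.
apply: (@no_biclique (w |: L) (nbr w :&: B)) => //.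
- by rewrite cardsU1 wL cardL.
- rewrite -setI_eq0; apply/eqP/setP=> x; rewrite in_setI in_setU1 in_setI in_set0.
  apply/negP=> /and3P [/orP [/eqP ->|xL]]; first by rewrite inE adj_irr.
  by move=> _ /common_nbrs_notin; rewrite xL.
- move=> x y; rewrite in_setU1 in_setI inE => /orP [/eqP -> /andP [] //|xL /andP [_]].
  by move/common_nbrsP => /(_ x xL); rewrite adj_sym.
Qed.

(** The degree of w is at most q plus the number of vertices that miss a hub, so it
    is a small multiple of n, and the two-step bound makes z w small. *)
Lemma z_off_hub w : w \notin L -> z w <= eps.
Proof.
move=> wL; have dw : deg w <= q%:R + 2 * g%:R * eta * n.
  apply: le_trans (_ : (#|nbr w :&: B| + #|~: B|)%:R <= _).
    rewrite ler_nat -(cardsID B (nbr w)) leq_add2l; apply/subset_leq_card/subsetP=> x.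
    by rewrite !inE => /andP [].
  by rewrite natrD lerD ?card_not_common // ler_nat ltnW // off_hub_common.
have := two_step_deg w; rewrite mulrA => h.
have dC : delta * C%:R * n <= eta / 2 * n by rewrite ler_wpM2r // ltW // order_gt0.
have h2 : n / 2 * z w <= lam ^+ 2 * z w by rewrite ler_wpM2r // lam_sq_half.
have g2 : 0 <= g%:R ^+ 2 :> R by rewrite exprn_ge0.
have h3 : g%:R * deg w <= g%:R * q%:R + 2 * g%:R ^+ 2 * eta * n.
  have -> : g%:R * q%:R + 2 * g%:R ^+ 2 * eta * n = g%:R * (q%:R + 2 * g%:R * eta * n) by ring.
  by rewrite ler_wpM2l.
have h4 : n / 2 * z w <= n / 2 * eps.
  have -> : n / 2 * eps = eta * n + 2 * g%:R ^+ 2 * eta * n by rewrite /eps; field.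
  have := n_big; lra.
by rewrite ler_pM2l // in h4; rewrite divr_gt0 // order_gt0.
Qed.

Let rest (u : G) : R := \sum_(w | adj u w && (w \notin L)) z w.

Lemma off_hub_bound_ge0 : 0 <= eps.
Proof.
by rewrite mulr_ge0 ?mulr_ge0 ?(ltW eta0) // addr_ge0 // mulr_ge0 ?exprn_ge0.
Qed.

(** At least half of the vertices are adjacent to all hubs, and at most a quarter have
    degree above 4 C. *)
Lemma many_light_common : exists2 U : {set G}, #|U| = m &
  forall u, u \in U -> u \in B /\ rest u <= eps * (4 * C + q)%:R.
Proof.
pose H : {set G} := [set u | (4 * C < #|nbr u|)%N].
have C0 : 0 < C%:R :> R by rewrite ltr0n.
have hH v : v \in H -> 4 * C%:R <= deg v.
  by rewrite inE => /ltnW; rewrite -(ler_nat R) natrM.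
have cardH : #|H|%:R <= n / 4.
  by rewrite -(ler_pM2r C0); have := heavy_markov hH; lra.
have [|U sU cardU] := @exists_subset_card _ (B :\: H) m.
  rewrite -(ler_nat R); apply: le_trans n_m _.
  have : n <= #|B :\: H|%:R + (#|~: B|%:R + #|H|%:R).
    rewrite -!natrD ler_nat -(cardsC (B :\: H)) leq_add2l setCD.
    exact: leq_card_setU.
  have := card_not_common; have : 4 * g%:R * eta * n <= 1 * n.
    by rewrite ler_wpM2r // ltW // order_gt0.
  move: cardH; lra.
exists U => // u /(subsetP sU); rewrite in_setD => /andP [uH uB]; split=> //.
apply: le_trans (_ : eps * #|nbr u|%:R <= _).
  apply: sum_le_card => [|w /andP []|w /andP [_ wL]]; rewrite ?off_hub_bound_ge0 ?inE //.
  exact: z_off_hub.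
rewrite ler_wpM2l ?off_hub_bound_ge0 // ler_nat; move: uH; rewrite inE -leqNgt => uH.
exact: leq_trans (leq_addr _ _).
Qed.

(** Among the vertices that miss a hub, one has at most C neighbours of the same
    kind, by the density bound; it has fewer than q neighbours adjacent to all
    hubs, and so little weight around it besides the hubs. *)
Lemma deficient_vertex v0 : v0 \notin L -> v0 \notin B ->
  exists v, v \notin L /\ lam * z v <= \sum_(l in L) z l - (1 - eta) + eps * (4 * C + q)%:R.
Proof.
move=> v0L v0B; pose E := ~: (L :|: B).
have v0E : v0 \in E by rewrite !inE in v0B *; rewrite negb_or v0L.
have [v vE dv] : exists2 v, v \in E & (#|nbr v :&: E| <= C)%N.
  apply/exists_inP; apply: contraTT (sparse E); rewrite negb_exists_in => /forall_inP big.
  rewrite -ltnNge; apply: (@leq_trans (\sum_(x in E) C.+1)).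
    rewrite sum_nat_const mulnC ltn_pmul2l //; by apply/card_gt0P; exists v0.
  by apply: leq_sum => v /big; rewrite -ltnNge.
move: (vE); rewrite !inE negb_or => /andP [vL vB]; exists v; split=> //.
have [l0 l0L l0v] : exists2 l, l \in L & ~~ adj v l.
  move: vB; rewrite negb_forall => /existsP [l]; rewrite negb_imply => /andP [lL].
  by exists l.
rewrite -z_eigen (bigID (mem L)) /=; apply: lerD.
  rewrite lerBrDr; apply: le_trans (_ : \sum_(w | adj v w && (w \in L)) z w + z l0 <= _);
    first by rewrite lerD2l zL.
  rewrite [leRHS](bigD1 l0) //= addrC lerD2r big_mkcond [leRHS]big_mkcond.
  apply: ler_sum => w _; case: (boolP (adj v w)) => vw /=; last by case: ifP.
  case: (w \in L) => //=; case: eqP => // wl; by rewrite wl (negPf l0v) in vw.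
apply: le_trans (_ : eps * #|(nbr v :&: B) :|: (nbr v :&: E)|%:R <= _).
  apply: sum_le_card => [|w /andP [vw wL]|w /andP [_ wL]]; rewrite ?off_hub_bound_ge0 //.
    rewrite !in_setU !in_setI in_setC in_setU (negPf wL) inE vw /=.
    by case: (w \in B).
  exact: z_off_hub.
rewrite ler_wpM2l ?off_hub_bound_ge0 // ler_nat; apply: leq_trans (leq_card_setU _ _) _.
rewrite addnC; apply: leq_add; last exact/ltnW/off_hub_common.
by apply: leq_trans dv _; rewrite leq_pmull.
Qed.

End Hubs.
End Structure.
End Weights.

Lemma addn4_le a b c d n : a + b + c + d <= n -> [/\ a <= n, b <= n, c <= n & d <= n].
Proof. by move=> le; split; lia. Qed.

Section Asymptotics.
Local Open Scope ring_scope.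
Variable R : realType.

Lemma eventually_linear (a b : R) : 0 < b ->
  exists N : nat, forall n : nat, (N <= n)%N -> a < b * n%:R.
Proof.
move=> b0; exists (Num.bound (`|a| / b)) => n Nn.
rewrite mulrC -ltr_pdivrMr //; apply: le_lt_trans (_ : `|a| / b < _).
  by rewrite ler_pM2r ?invr_gt0 // ler_norm.
apply: lt_le_trans (archi_boundP _) _; first by rewrite divr_ge0 // ltW.
by rewrite ler_nat.
Qed.

(** The section above with the constants chosen in order: eta from tau, delta from
    eta, K from delta, and only then the threshold on the order of G. *)
Lemma hubs_eventually (g q C m : nat) (tau : R) : (0 < g)%N -> (0 < C)%N -> 0 < tau ->
  exists N : nat, forall (G : graph) (z : G -> R) (lam : R), (N <= #|G|)%N ->
  (forall A : {set G}, (\sum_(x in A) #|nbr x :&: A| <= C * #|A|)%N) ->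
  (forall X Y : {set G}, #|X| = g.+1 -> (q <= #|Y|)%N ->
    [disjoint X & Y] -> (forall x y, x \in X -> y \in Y -> adj x y) -> False) ->
  (forall v, 0 <= z v) -> (forall v, z v <= 1) -> (exists v, z v = 1) ->
  (forall v, \sum_(w | adj v w) z w = lam * z v) ->
  0 < lam -> g%:R * (#|G|%:R - g%:R) <= lam ^+ 2 ->
  exists L U : {set G}, [/\ #|L| = g, forall l, l \in L -> 1 - tau <= z l &
    [/\ #|U| = m, forall u l, u \in U -> l \in L -> adj u l,
      forall u, u \in U -> \sum_(w | adj u w && (w \notin L)) z w <= tau &
      (forall v l, v \notin L -> l \in L -> adj v l) \/
      exists v, v \notin L /\ lam * z v <= \sum_(l in L) z l - 1 + 2 * tau]].
Proof.
move=> g0 C0 tau0.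
have C0' : 0 < C%:R :> R by rewrite ltr0n.
pose c : R := 2 * (4 * C + q)%:R * (1 + 2 * g%:R ^+ 2) + 4 * g%:R + 2.
(* The three summands of c give the conditions on eta below. *)
pose t := Num.min 1 tau; pose eta := t / c; pose delta := eta / (2 * C%:R).
have t0 : 0 < t by rewrite lt_min ltr01.
have c1 : 0 <= 2 * (4 * C + q)%:R * (1 + 2 * g%:R ^+ 2) :> R.
  by rewrite mulr_ge0 ?mulr_ge0 // addr_ge0 // mulr_ge0 ?exprn_ge0.
have c2 : 0 <= 4 * g%:R :> R by rewrite mulr_ge0.
have cpos : 0 < c by rewrite /c; lra.
have eta0 : 0 < eta by rewrite divr_gt0.
have etac : eta * c = t by rewrite divfK ?gt_eqF.
have [t1 t2] : t <= 1 /\ t <= tau by rewrite !ge_min !lexx orbT.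
have e1 : 0 <= eta * (2 * (4 * C + q)%:R * (1 + 2 * g%:R ^+ 2)) by rewrite mulr_ge0 // ltW.
have e2 : 0 <= eta * (4 * g%:R) by rewrite mulr_ge0 // ltW.
have etaE : eta * (2 * (4 * C + q)%:R * (1 + 2 * g%:R ^+ 2)) + eta * (4 * g%:R) + eta * 2 = t.
  by rewrite -etac /c; ring.
have delta0 : 0 < delta by rewrite divr_gt0 // mulr_gt0.
have deltaC : delta * C%:R <= eta / 2.
  by rewrite le_eqVlt; apply/orP; left; apply/eqP; rewrite /delta; field; rewrite gt_eqF.
pose K := Num.bound (4 * C%:R ^+ 2 / delta).
have K1 : 4 * C%:R ^+ 2 / delta < K%:R.
  rewrite /K; apply: archi_boundP; apply: divr_ge0; last exact: ltW.
  by rewrite mulr_ge0 // exprn_ge0.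
have [N1 N1P] := @eventually_linear (((64 * C%:R ^+ 3) / delta ^+ 2) ^+ 2) (1 / 2) (ltac:(lra)).
have [N2 N2P] := @eventually_linear
  (K%:R * (K + 2 ^ K * q)%:R + g%:R ^+ 2 + g%:R * q%:R) (eta / 2) (ltac:(lra)).
have [N3 N3P] := @eventually_linear m%:R (1 / 4) (ltac:(lra)).
exists (N1 + N2 + N3 + g.*2)%N => G z lam NG sparse nobi z0 z1 zmax zE lam0 lamsq.
have {NG} [NG1 NG2 NG3 NG4] := addn4_le NG.
have n2g : g.*2%:R <= #|G|%:R :> R by rewrite ler_nat.
have heavyK := heavy_bounded g0 C0 sparse z1 zE lam0 lamsq n2g delta0.
have {}heavyK : (#|[set v | (delta < z v)%R]| <= K)%N.
  rewrite -(ler_nat R); apply: le_trans (ltW K1); apply: heavyK => //.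
  by apply: le_trans (ltW (N1P _ NG1)) _; lra.
have n_big := N2P #|G| NG2.
have n_m : m%:R <= #|G|%:R / 4 :> R.
  by apply: le_trans (ltW (N3P _ NG3)) _; lra.
have eta_half : eta <= 1 / 2 by lra.
have g_eta : 4 * g%:R * eta <= 1 by rewrite mulrC; lra.
have [L cardL zL] := hubs_exist g0 sparse nobi z1 zE lamsq eta_half delta0 deltaC heavyK n_big zmax.
have eps_tau : 2 * eta * (1 + 2 * g%:R ^+ 2) * (4 * C + q)%:R <= tau.
  have -> : 2 * eta * (1 + 2 * g%:R ^+ 2) * (4 * C + q)%:R =
    eta * (2 * (4 * C + q)%:R * (1 + 2 * g%:R ^+ 2)) by ring.
  lra.
have [U cardU UP] := many_light_common g0 C0 sparse nobi z0 z1 zE lamsq n2g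
  eta0 eta_half g_eta delta0 deltaC heavyK n_big n_m cardL zL.
exists L, U; split=> // [l /zL|]; first by apply: le_trans; lra.
split=> // [u l /UP [/common_nbrsP uB _]|u /UP [_]|]; first exact: uB.
  by move=> h; apply: le_trans h eps_tau.
have [/existsP [v0 /andP [v0L v0B]]|none] :=
    boolP [exists v, (v \notin L) && (v \notin common_nbrs L)]; last first.
  left=> v l vL; apply/common_nbrsP; apply: contraNT none => vB.
  by apply/existsP; exists v; rewrite vL.
right; have [v [vL vle]] := deficient_vertex g0 sparse nobi z0 z1 zE lamsq n2g
  eta0 eta_half delta0 deltaC heavyK n_big cardL zL v0L v0B.
by exists v; split=> //; lra.
Qed.
End Asymptotics.

(** * Rewiring increases the spectral radius *)
Section RewireRadius.
Local Open Scope ring_scope.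
Variables (R : realType) (G : graph) (L W : {set G}) (z : G -> R) (lam : R).
Hypothesis LW : [disjoint L & W].
Hypothesis z_ge0 : forall v, 0 <= z v.
Hypothesis lam_gt0 : 0 < lam.
Hypothesis z_eigen : forall v, \sum_(w | adj v w) z w = lam * z v.

Let sigma := \sum_(l in L) z l.
Let y (v : G) : R := if v \in W then sigma / lam else z v.
Let missing (l : G) : R := \sum_(l' in L | (l != l') && ~~ adj l l') z l'.
Local Notation G' := (rewire L W).

Lemma test_hub l : l \in L -> y l = z l.
Proof. by move=> lL; rewrite /y (disjointFr LW lL). Qed.

Lemma nbr_sum_twin (v : G') : v \in W -> \sum_(w : G' | adj v w) y w = sigma.
Proof.
move=> vW; rewrite (eq_bigl (fun w => w \in L)) => [|w]; last by rewrite adj_rewire_twin.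
by apply: eq_bigr => l lL; rewrite test_hub.
Qed.

Lemma nbr_sum_off (v : G') : v \notin L -> v \notin W ->
  \sum_(w : G' | adj v w) y w = lam * z v - \sum_(w | @adj G v w && (w \in W)) z w.
Proof.
move=> vL vW; rewrite (eq_bigl (fun w => @adj G v w && (w \notin W))) => [|w]; last first.
  by rewrite adj_rewire_off // andbC.
rewrite -z_eigen [in RHS](bigID (mem W)) /= [X in _ = X - _]addrC addrK.
by apply: eq_bigr => w /andP [_ /negPf wW]; rewrite /y wW.
Qed.

Lemma nbr_sum_hub (v : G') : v \in L ->
  \sum_(w : G' | adj v w) y w = lam * z v - \sum_(w | @adj G v w && (w \in W)) z w
    + missing v + #|W|%:R * (sigma / lam).
Proof.
move=> vL; rewrite (eq_bigl (fun w => (v != w) && ((w \in L :|: W) || @adj G v w))); last first.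
  by move=> w; rewrite adj_rewire_hub.
rewrite -z_eigen [X in _ = X - _ + _ + _](bigID (mem W)) /=.
rewrite [X in _ = X - _ + _ + _]addrC addrK (bigID (mem W)) /= addrC; congr (_ + _); last first.
  rewrite (eq_bigl (fun w => w \in W)) => [|w]; last first.
    rewrite /=; case: (boolP (w \in W)) => wW; rewrite ?andbF //.
    rewrite in_setU wW orbT /= !andbT; apply: contraTneq wW => <-.
    by rewrite (disjointFr LW vL).
  rewrite (eq_bigr (fun _ => sigma / lam)) => [|w wW]; last by rewrite /y wW.
  by rewrite sumr_const mulr_natl.
rewrite (bigID (fun w => @adj G v w)) /=; congr (_ + _).
  apply: congr_big => // [w|w /andP [/andP [_ /negPf wW] _]]; last by rewrite /y wW.
  case: (boolP (@adj G v w)) => vw; rewrite ?andbF //=.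
  by rewrite orbT (adj_neq vw) !andbT.
apply: congr_big => // [w|w /andP [/andP [_ /negPf wW] _]]; last by rewrite /y wW.
rewrite in_setU.
case: (boolP (w \in L)) => wL; first by rewrite (disjointFr LW wL) /= !andbT.
by case: (w \in W); case: (@adj G v w); rewrite ?andbF.
Qed.

(** The test vector agrees with z off W and takes on W the value sigma / lam that the
    eigenvalue equation would prescribe for a vertex with neighbourhood L. Net of
    lam times the squared norm, removing the edges at w in W costs at most
    lam * (z w)^2 and joining w to L gains sigma^2 / lam, while the first sum
    accounts for the new edges inside L. *)
Lemma quad_rewire_ge :
  lam * (\sum_v y v ^+ 2) + \sum_(l in L) z l * missing l
    + \sum_(w in W) (sigma ^+ 2 - (lam * z w) ^+ 2) / lam
  <= \sum_v \sum_(w : G' | adj v w) y v * y w.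
Proof.
have sq : \sum_v y v ^+ 2 = \sum_(v | v \notin W) z v ^+ 2 + #|W|%:R * (sigma / lam) ^+ 2.
  rewrite (bigID (mem W)) /= addrC; congr (_ + _).
    by apply: eq_bigr => v /negPf vW; rewrite /y vW.
  rewrite (eq_bigr (fun _ => (sigma / lam) ^+ 2)) => [|w wW]; last by rewrite /y wW.
  by rewrite sumr_const mulr_natl.
pose cut v := \sum_(w | @adj G v w && (w \in W)) z w.
pose N (v : G) := \sum_(w : G' | @adj G' v w) y w.
have -> : \sum_v \sum_(w : G' | adj v w) y v * y w = \sum_v y v * N v.
  by apply: eq_bigr => v _; rewrite /N mulr_sumr.
have -> : \sum_v y v * N v =
    #|W|%:R * (sigma / lam * sigma) + (lam * (\sum_(v | v \notin W) z v ^+ 2)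
     - \sum_(v | v \notin W) z v * cut v + \sum_(l in L) z l * missing l
     + sigma * (#|W|%:R * (sigma / lam))).
  rewrite (bigID (mem W)) /=; congr (_ + _).
    rewrite (eq_bigr (fun _ => sigma / lam * sigma)) => [|v vW].
      by rewrite sumr_const mulr_natl.
    by rewrite (nbr_sum_twin vW : N v = _) /y vW.
  have LsubW (F : G -> R) : \sum_(l in L) F l = \sum_(v | v \notin W) if v \in L then F v else 0.
    rewrite -big_mkcondr; apply: eq_bigl => l; case: (boolP (l \in L)) => lL; rewrite ?andbF //.
    by rewrite (disjointFr LW lL).
  rewrite [sigma * _]mulr_suml !LsubW mulr_sumr -sumrB -!big_split.
  apply: eq_bigr => v vW /=; rewrite /y (negPf vW).
  case: ifPn => vL; first by rewrite (nbr_sum_hub vL : N v = _) -/(cut v); ring.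
  by rewrite (nbr_sum_off vL vW : N v = _) -/(cut v); ring.
have cut_le : \sum_(v | v \notin W) z v * cut v <= \sum_(w in W) lam * z w ^+ 2.
  apply: le_trans (_ : \sum_v z v * cut v <= _).
    rewrite [leRHS](bigID (mem W)) /= lerDr; apply: sumr_ge0 => v _.
    by rewrite mulr_ge0 // sumr_ge0.
  have -> : \sum_v z v * cut v = \sum_(w in W) \sum_(v | adj w v) z v * z w.
    transitivity (\sum_v \sum_(w | adj v w && (w \in W)) z v * z w).
      by apply: eq_bigr => v _; rewrite mulr_sumr.
    rewrite (exchange_big_dep (mem W)) /= => [|v w _ /andP [] //].
    by apply: eq_bigr => w wW; apply: eq_bigl => v; rewrite wW andbT adj_sym.
  apply: ler_sum => w _; rewrite -mulr_suml z_eigen; rewrite le_eqVlt; apply/orP; left; apply/eqP; ring.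
have -> : \sum_(w in W) (sigma ^+ 2 - (lam * z w) ^+ 2) / lam =
    #|W|%:R * (sigma ^+ 2 / lam) - \sum_(w in W) lam * z w ^+ 2.
  rewrite mulr_natl -sumr_const -sumrB; apply: eq_bigr => w _.
  by field; rewrite gt_eqF.
rewrite sq.
have lE : lam * (#|W|%:R * (sigma / lam) ^+ 2) = #|W|%:R * (sigma ^+ 2 / lam).
  by field; rewrite gt_eqF.
have lE2 : #|W|%:R * (sigma / lam * sigma) = #|W|%:R * (sigma ^+ 2 / lam) by ring.
have lE3 : sigma * (#|W|%:R * (sigma / lam)) = #|W|%:R * (sigma ^+ 2 / lam) by ring.
rewrite mulrDr lE lE2 lE3; lra.
Qed.

Lemma rewire_radius_lt : (0 < #|G|)%N ->
  0 < \sum_(l in L) z l * missing l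
      + \sum_(w in W) (sigma ^+ 2 - (lam * z w) ^+ 2) / lam ->
  lam < spectral_radius R (rewire L W).
Proof.
move=> G0 gain; have [_ [_ _ _ /(_ y)]] := @spectral_perron R G' G0.
rewrite ltNge; move=> le; apply/negP=> small.
have := quad_rewire_ge; move=> ge.
have : spectral_radius R G' * (\sum_v y v ^+ 2) <= lam * (\sum_v y v ^+ 2).
  by apply: ler_wpM2r => //; apply: sumr_ge0 => v _; apply: sqr_ge0.
move: (le_trans ge le); move: gain; lra.
Qed.

End RewireRadius.

(** * Extremal graphs have complete hubs *)
Section ExtremalHubs.
Local Open Scope ring_scope.
Variable R : realType.

Lemma perron_normalized (G : graph) : (0 < #|G|)%N ->
  exists z : G -> R, [/\ forall v, 0 <= z v, forall v, z v <= 1, exists v, z v = 1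
  & forall v, \sum_(w | adj v w) z w = spectral_radius R G * z v].
Proof.
move=> G0; have [z [z0 [v1 zv1] zE _]] := @spectral_perron R G G0.
case: (@Order.TotalTheory.arg_maxP _ _ _ v1 xpredT z isT) => v0 _ vmax.
have zv0 : 0 < z v0.
  by apply: lt_le_trans (vmax v1 isT); rewrite lt_neqAle eq_sym zv1 z0.
exists (fun v => z v / z v0); split.
- by move=> v; rewrite divr_ge0 ?z0.
- by move=> v; rewrite ler_pdivrMr // mul1r; apply: vmax.
- by exists v0; rewrite divff ?gt_eqF.
- by move=> v; rewrite -mulr_suml zE mulrA.
Qed.

(** Rayleigh quotient of the vector with value rho on the hubs and s on the rest. *)
Lemma book_radius s t : (0 < s)%N -> (0 < t)%N ->
  0 < spectral_radius R (book s t) /\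
  s%:R * t%:R <= spectral_radius R (book s t) ^+ 2.
Proof.
move=> s0 t0; set rho := spectral_radius R _.
have G0 : (0 < #|book s t|)%N by rewrite card_sum card_ord ltn_addr.
have [_ [_ _ _ ray]] := @spectral_perron R _ G0.
have key (a b : R) : 0 <= a -> 0 <= b ->
    2 * s%:R * t%:R * a * b <= rho * (s%:R * a ^+ 2 + t%:R * b ^+ 2).
  move=> a0 b0; pose y (v : book s t) : R := if v is inl _ then a else b.
  have y0 v : 0 <= y v by case: v.
  have -> : s%:R * a ^+ 2 + t%:R * b ^+ 2 = \sum_v y v ^+ 2.
    by rewrite big_sumType /= !sumr_const !card_ord !mulr_natl.
  apply: le_trans (ray y); rewrite [leRHS]big_sumType /=.
  have -> : 2 * s%:R * t%:R * a * b =
      \sum_(i < s) t%:R * a * b + \sum_(i < t) s%:R * a * b.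
    rewrite !sumr_const !card_ord -[(t%:R * a * b) *+ s]mulr_natl.
    by rewrite -[(s%:R * a * b) *+ t]mulr_natl; ring.
  apply: lerD; apply: ler_sum => i _.
    rewrite [leRHS]big_mkcond big_sumType /= ler_wpDl //.
      by apply: sumr_ge0 => j _; case: ifP => // _; rewrite mulr_ge0.
    by rewrite sumr_const card_ord -[(a * b) *+ t]mulr_natl mulrA.
  rewrite [leRHS]big_mkcond big_sumType /= ler_wpDr //.
    by apply: sumr_ge0 => j _; case: ifP => // _; rewrite mulr_ge0.
  rewrite sumr_const card_ord -[(b * a) *+ s]mulr_natl.
  by rewrite le_eqVlt; apply/orP; left; apply/eqP; ring.
have s1 : 0 < s%:R :> R by rewrite ltr0n.
have t1 : 0 < t%:R :> R by rewrite ltr0n.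
have rho0 : 0 < rho.
  have := key 1 1 ler01 ler01; rewrite !expr1n !mulr1 => h.
  rewrite -(@pmulr_lgt0 _ (s%:R + t%:R)) ?addr_gt0 //; apply: lt_le_trans h.
  by rewrite !mulr_gt0.
split=> //; have := key rho s%:R (ltW rho0) (ltW s1).
have -> : 2 * s%:R * t%:R * rho * s%:R = (rho * s%:R) * (2 * (s%:R * t%:R)) by ring.
have -> : rho * (s%:R * rho ^+ 2 + t%:R * s%:R ^+ 2) =
  (rho * s%:R) * (rho ^+ 2 + s%:R * t%:R) by ring.
rewrite ler_pM2l ?mulr_gt0 //; lra.
Qed.

(** The set W consists of #|F| + g vertices of small degree adjacent to all hubs,
    which is what transporting a model back requires, and of a vertex that misses
    a hub, if there is one. The former lose at most 2 g tau + tau^2 each in the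
    sum of [rewire_radius_lt], up to its factor 1 / lam; tau is chosen such that
    this is outweighed by the gain at the missing edge. *)
Lemma extremal_hubs (F : graph) (A : {set F}) (g : nat) : (0 < g)%N ->
  (forall f f', f \in A -> f' \in A -> ~~ adj f f') -> (#|~: A| <= g.+1)%N ->
  (forall Z : {set F}, (#|F| <= #|Z| + g)%N ->
     exists f f', [/\ f \in Z, f' \in Z & adj f f']) ->
  exists N : nat, forall (n : nat) (G : graph), (N <= n)%N -> in_SPEX_minor R n F G ->
  exists2 L : {set G}, #|L| = g & forall x y, x \in L -> x != y -> adj x y.
Proof.
move=> g0 indA cardA edgeF.
pose m := (#|F| + g)%N; pose c : R := 4 * (m%:R + 1) * (2 * g%:R + 1).
pose tau := 1 / c.
have g1 : 1 <= g%:R :> R by rewrite ler1n.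
have m0 : 0 <= m%:R :> R by [].
have c12 : 12 <= c.
  have : 0 <= m%:R * g%:R :> R by rewrite mulr_ge0.
  rewrite /c mulrDr mulrDl mulr1; lra.
have c0 : 0 < c by lra.
have tau0 : 0 < tau by rewrite divr_gt0.
have tauc : tau * c = 1 by rewrite divfK ?gt_eqF.
have tau12 : tau <= 1 / 12 by rewrite /tau ler_pdivrMr //; lra.
have loss : m%:R * (2 * g%:R * tau + tau ^+ 2) <= 1 / 4.
  have t2 : tau ^+ 2 <= tau by rewrite expr2 ger_pMl //; lra.
  have : m%:R * (2 * g%:R * tau + tau ^+ 2) <= m%:R * (2 * g%:R * tau + tau).
    by rewrite ler_wpM2l // lerD2l.
  have : 0 <= tau * (2 * g%:R + 1) by rewrite mulr_ge0 ?ltW //; lra.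
  move: tauc; rewrite /c; lra.
have [N NP] := @hubs_eventually R g #|F| (2 ^ #|F|) m tau g0 (expn_gt0 _ _) tau0.
exists (N + g.+1)%N => n G Nn [cardG nF ext].
have nM : ~ has_model F G by move/has_model_minor.
have nG : (N <= #|G|)%N by rewrite cardG; apply: leq_trans Nn; apply: leq_addr.
have gn : (g < n)%N by apply: leq_trans Nn; apply: leq_addl.
have t0 : (0 < n - g)%N by rewrite subn_gt0.
have G0 : (0 < #|G|)%N by rewrite cardG; apply: leq_trans gn.
have [rho0 rhosq] := book_radius g0 t0.
have rho_le : spectral_radius R (book g (n - g)) <= spectral_radius R G.
  apply: ext; first by rewrite card_sum !card_ord subnKC // ltnW.
  move/minor_has_model.
  pose hubs : {set book g (n - g)} := [set v | if v is inl _ then true else false].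
  have card_hubs : #|hubs| = g.
    rewrite -[RHS]card_ord -cardsT -(card_imset _ (@inl_inj 'I_g 'I_(n - g))).
    apply: eq_card => -[i|i]; rewrite inE; first by rewrite imset_f ?inE.
    by apply/esym/imsetP => -[].
  apply: (@independent_rest_model_free _ _ hubs).
    by move=> [i|i] [j|j]; rewrite ?inE //= /adj /= /adj /= !andbF.
  by move=> Z; rewrite card_hubs; apply: edgeF.
pose lam := spectral_radius R G.
have lam0 : 0 < lam by apply: lt_le_trans rho_le.
have lam_sq : g%:R * (#|G|%:R - g%:R) <= lam ^+ 2.
  rewrite cardG -natrB ?(ltnW gn) //; apply: le_trans rhosq _.
  by rewrite ler_pXn2r ?nnegrE ?(ltW rho0) ?(ltW lam0).
have lam1 : 1 <= lam.
  rewrite -(@expr_ge1 _ 2) ?(ltW lam0) //; apply: le_trans lam_sq.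
  rewrite cardG -natrB ?(ltnW gn) // -natrM ler1n muln_gt0 g0 //.
have [z [z0 z1 zmax zE]] := perron_normalized G0.
have sparse B := model_free_sparse B nM.
have [|L [U [cardL zL [cardU UL Urest alt]]]] :=
    NP G z lam nG sparse _ z0 z1 zmax zE lam0 lam_sq.
  move=> X Y cardX cardY dXY XY; apply: nM.
  by apply: (biclique_model indA _ cardY dXY XY); rewrite cardX.
exists L => //.
pose sigma := \sum_(l in L) z l.
have ULd u : u \in U -> u \notin L.
  by move=> uU; apply/negP=> /(UL _ _ uU); rewrite adj_irr.
have no_gain (W : {set G}) : [disjoint L & W] -> U \subset W ->
    \sum_(l in L) z l * (\sum_(l' in L | (l != l') && ~~ adj l l') z l')
      + \sum_(w in W) (sigma ^+ 2 - (lam * z w) ^+ 2) / lam <= 0.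
  move=> LW UW; rewrite leNgt; apply/negP=> gain.
  have := rewire_radius_lt LW z0 lam0 zE G0 gain.
  rewrite ltNge; move/negP; apply; apply: ext => //.
  move/minor_has_model/(rewire_has_model LW UW) => h; apply: nM; apply: h => //.
  by rewrite cardL cardU.
have [s1 s2] : 1 - tau <= sigma /\ sigma <= g%:R.
  split; last first.
    by rewrite /sigma -cardL -sumr_const; apply: ler_sum.
  have /card_gt0P [l lL] : (0 < #|L|)%N by rewrite cardL.
  rewrite /sigma (bigD1 l) //=; apply: le_trans (zL l lL) _; rewrite lerDl.
  by apply: sumr_ge0.
have Uloss u : u \in U -> - (2 * g%:R * tau + tau ^+ 2) <= sigma ^+ 2 - (lam * z u) ^+ 2.
  move=> uU; have : lam * z u <= sigma + tau.
    rewrite -zE (bigID (mem L)) /=; apply: lerD (Urest u uU).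
    rewrite le_eqVlt; apply/orP; left; apply/eqP; apply: eq_bigl => l.
    by case: (boolP (l \in L)) => lL; rewrite ?andbF // UL.
  have : 0 <= lam * z u by rewrite mulr_ge0 ?z0 // ltW.
  move: (lam * z u) => x x0 xs.
  have : x ^+ 2 <= (sigma + tau) ^+ 2 by rewrite ler_pXn2r ?nnegrE //; lra.
  have : sigma * tau <= g%:R * tau by rewrite ler_wpM2r // ltW.
  rewrite sqrrD; lra.
have Wloss (P : pred G) : (forall w, P w -> w \in U) ->
    - (m%:R * (2 * g%:R * tau + tau ^+ 2)) / lam <=
    \sum_(w | P w) (sigma ^+ 2 - (lam * z w) ^+ 2) / lam.
  move=> PU; set k := 2 * g%:R * tau + tau ^+ 2.
  have k0 : 0 <= k.
    have t := ltW tau0.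
    by rewrite /k addr_ge0 // ?exprn_ge0 // mulr_ge0 // mulr_ge0.
  apply: le_trans (_ : \sum_(w | P w) - k / lam <= _).
    rewrite sumr_const -[leRHS]mulr_natr (_ : - (m%:R * k) / lam = (- k / lam) * m%:R); last by ring.
    apply: ler_wnM2l; first by rewrite mulNr oppr_le0 divr_ge0 // ltW.
    by rewrite -cardU ler_nat; apply/subset_leq_card/subsetP=> w; apply: PU.
  by apply: ler_sum => w /PU /Uloss; rewrite ler_pM2r ?invr_gt0.
have hub_gain0 : 0 <= \sum_(l in L) z l * (\sum_(l' in L | (l != l') && ~~ adj l l') z l').
  by apply: sumr_ge0 => l _; rewrite mulr_ge0 // sumr_ge0.
have full v l : v \notin L -> l \in L -> adj v l.
  case: alt => [h|[v0 [v0L v0z]] _ _]; first exact: h.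
  exfalso; have LW : [disjoint L & v0 |: U].
    rewrite -setI_eq0; apply/eqP/setP=> x; rewrite in_setI in_setU1 in_set0.
    apply/negP=> /andP [xL /orP [/eqP xv|/ULd]]; last by rewrite xL.
    by rewrite xv (negPf v0L) in xL.
  have := no_gain _ LW (finset.subsetUr _ _).
  rewrite [X in _ + X <= 0](bigD1 v0) ?setU11 //=.
  have term : 1 / 2 / lam <= (sigma ^+ 2 - (lam * z v0) ^+ 2) / lam.
    rewrite ler_pM2r ?invr_gt0 //.
    have : 0 <= lam * z v0 by rewrite mulr_ge0 ?z0 // ltW.
    move: v0z; rewrite -/sigma; move: (lam * z v0) => x v0z x0.
    have : x ^+ 2 <= (sigma - 1 + 2 * tau) ^+ 2 by rewrite ler_pXn2r ?nnegrE //; lra.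
    have : 0 <= (1 / 3 - 2 * tau) * (2 * sigma - 1 + 2 * tau).
      by rewrite mulr_ge0 //; lra.
    have -> : (sigma - 1 + 2 * tau) ^+ 2 = sigma ^+ 2 - (1 - 2 * tau) * (2 * sigma - 1 + 2 * tau) by ring.
    lra.
  have rest : - (1 / 4) / lam <=
      \sum_(w in v0 |: U | w != v0) (sigma ^+ 2 - (lam * z w) ^+ 2) / lam.
    apply: le_trans (Wloss (fun w => (w \in v0 |: U) && (w != v0)) _); last first.
      by move=> w /andP []; rewrite in_setU1 => /orP [->|].
    by rewrite ler_pM2r ?invr_gt0 // lerN2.
  have alg (a b d k : R) : 0 <= a -> 1 / 2 * k <= b -> - (1 / 4) * k <= d -> 0 < k ->
      a + (b + d) <= 0 -> False by lra.
  by apply: alg hub_gain0 term rest _; rewrite invr_gt0.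
move=> x y xL xy; have [yL|yL] := boolP (y \in L); last by rewrite adj_sym full.
apply: contraT => nxy; exfalso.
have LU : [disjoint L & U].
  rewrite -setI_eq0; apply/eqP/setP=> w; rewrite in_setI in_set0.
  by apply/negP=> /andP [wL /ULd]; rewrite wL.
have := no_gain U LU (subxx _).
have rest : - (1 / 4) / lam <= \sum_(w in U) (sigma ^+ 2 - (lam * z w) ^+ 2) / lam.
  apply: le_trans (Wloss _ _) => //.
  by rewrite ler_pM2r ?invr_gt0 // lerN2.
have rest' : - (1 / 4) <= - (1 / 4) / lam.
  by rewrite mulNr lerN2 ler_pdivrMr //; lra.
have : 1 / 2 <= \sum_(l in L) z l * (\sum_(l' in L | (l != l') && ~~ adj l l') z l').
  rewrite (bigD1 x) //= (bigD1 y) /=; last by rewrite yL xy nxy.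
  have zxy : 1 / 2 <= z x * z y.
    apply: le_trans (_ : (1 - tau) * (1 - tau) <= _); first by nra.
    by apply: ler_pM; rewrite ?zL //; lra.
  apply: le_trans zxy _; rewrite mulrDr -addrA lerDl addr_ge0 //.
    by rewrite mulr_ge0 // sumr_ge0.
  by apply: sumr_ge0 => l _; rewrite mulr_ge0 // sumr_ge0.
have alg (a b d : R) : d <= b -> - (1 / 4) <= d -> 1 / 2 <= a -> a + b <= 0 -> False by lra.
exact: alg rest rest'.
Qed.

End ExtremalHubs.

(** * Recognising books *)
Lemma giso_sym (G1 G2 : graph) : giso G1 G2 -> giso G2 G1.
Proof.
case=> f [f' fK f'K] fM; exists f'; first by exists f.
by move=> x y; rewrite -fM !f'K.
Qed.

Lemma giso_trans (G1 G2 G3 : graph) : giso G1 G2 -> giso G2 G3 -> giso G1 G3.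
Proof.
case=> f fB fM [h hB hM]; exists (h \o f); first exact: bij_comp.
by move=> x y /=; rewrite hM fM.
Qed.

Lemma giso_join_hubs (G : graph) (L : {set G}) s t k : #|L| = s ->
  (forall x y, x \in L -> x != y -> adj x y) ->
  giso (partial_matching t k) (induced (~: L)) -> giso (book_edges k s t) G.
Proof.
move=> cardL hubL [h hB hM].
pose f (v : book_edges k s t) : G := match v with
  | inl i => enum_val (cast_ord (esym cardL) i) | inr j => val (h j) end.
have fL i : f (inl i) \in L by apply: enum_valP.
have fR j : f (inr j) \notin L by have := valP (h j); rewrite inE.
have fI : injective f.
  move=> [i|i] [j|j] E.
  - by have /enum_val_inj /cast_ord_inj -> := E.
  - by have := fR j; rewrite -E fL.
  - by have := fR i; rewrite E fL.
  - by have /val_inj /(bij_inj hB) -> := E.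
exists f; last first.
  move=> [i|i] [j|j]; rewrite [in RHS]/adj /=.
  - have [->|ij] := eqVneq i j; first exact: adj_irr.
    by apply: hubL (fL i) _; apply: contra_neq ij => E; case: (fI (inl i) (inl j) E).
  - by apply: hubL (fL i) _; apply/eqP=> E; move: (fR j); rewrite -(E : f (inl i) = f (inr j)) fL.
  - rewrite adj_sym; apply: hubL (fL j) _.
    by apply/eqP=> E; move: (fR i); rewrite -(E : f (inl j) = f (inr i)) fL.
  - exact: hM.
apply: inj_card_bij => //.
have := bij_eq_card hB; rewrite card_induced /= card_ord => cardR.
by rewrite -(cardsC L) cardL card_sum /= !card_ord -cardR.
Qed.

Lemma giso_edgeless (G : graph) t : #|G| = t -> (forall x y : G, ~~ adj x y) ->
  giso (edgeless t) G.
Proof.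
move=> cardG no_edge; exists (fun i => enum_val (cast_ord (esym cardG) i)).
  apply: inj_card_bij; last by rewrite card_ord cardG.
  by move=> i j /enum_val_inj /cast_ord_inj.
by move=> i j; rewrite (negPf (no_edge _ _)) [in RHS]/adj /= !andbF.
Qed.

(** List the matched pairs one after the other and put the uncovered vertex last. *)
Lemma matching_enum (G : graph) (M : {set G}) :
  (forall x y z, x \in M -> y \in M -> z \in M -> adj x y -> adj x z -> y = z) ->
  (forall x y, x \in M -> y \in M -> (forall w, w \in M -> ~~ adj x w) ->
     (forall w, w \in M -> ~~ adj y w) -> x = y) ->
  exists s : seq G, [/\ uniq s, s =i M &
    forall x0 i j, i < size s -> j < size s ->
      adj (nth x0 s i) (nth x0 s j) = (i != j) && (i./2 == j./2)].
Proof.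
have [m] := ubnP #|M|; elim: m M => // m IH M Mm match_M iso_M.
have [/existsP [x /existsP [y /and3P [xM yM xy]]]|none] :=
    boolP [exists x, exists y, [&& x \in M, y \in M & adj x y]]; last first.
  have noE x y : x \in M -> y \in M -> ~~ adj x y.
    move=> xM yM; apply: contra none => xy.
    by apply/existsP; exists x; apply/existsP; exists y; rewrite xM yM.
  have M1 : #|M| <= 1.
    rewrite leqNgt; apply/negP=> /card_gt1P [x [y [xM yM xy]]]; case/eqP: xy.
    by apply: iso_M => // w; apply: noE.
  exists (enum M); split; [exact: enum_uniq|exact: mem_enum|].
  move=> x0 i j; rewrite -cardE => iM jM.
  have := leq_trans jM M1; have := leq_trans iM M1; rewrite !ltnS !leqn0.
  by move=> /eqP -> /eqP ->; rewrite adj_irr eqxx.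
have nxy := adj_neq xy.
have nbr_x w : w \in M -> adj x w -> w = y by move=> wM xw; apply: (match_M x).
have nbr_y w : w \in M -> adj y w -> w = x.
  by move=> wM yw; apply: (match_M y) => //; rewrite adj_sym.
pose M' := M :\ x :\ y.
have M'E w : (w \in M') = [&& w != y, w != x & w \in M] by rewrite !inE.
have [|x1 y1 z1||s [us sM' sadj]] := IH M'.
- rewrite ltnS in Mm; apply: leq_trans Mm; apply/proper_card/properP; split.
    by apply/subsetP=> w; rewrite M'E => /and3P [].
  by exists x => //; rewrite M'E eqxx andbF.
- rewrite !M'E => /and3P [_ _ ?] /and3P [_ _ ?] /and3P [_ _ ?]; exact: match_M.
- have iso' w : w \in M' -> (forall u, u \in M' -> ~~ adj w u) ->
      forall u, u \in M -> ~~ adj w u.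
    rewrite M'E => /and3P [wy wx wM] iso u uM; apply/negP=> wu.
    have [ux|ux] := eqVneq u x.
      by case/eqP: wy; apply: nbr_x => //; rewrite -ux adj_sym.
    have [uy|uy] := eqVneq u y.
      by case/eqP: wx; apply: nbr_y => //; rewrite -uy adj_sym.
    have : ~~ adj w u by apply: iso; rewrite M'E uy ux uM.
    by rewrite wu.
  move=> x1 y1 x1M y1M isox isoy; apply: iso_M; try exact: iso';
  by move: x1M y1M; rewrite !M'E => /and3P [_ _ ?] /and3P [].
have xs : x \notin s by rewrite sM' M'E eqxx andbF.
have ys : y \notin s by rewrite sM' M'E eqxx.
exists [:: x, y & s]; split.
- by rewrite /= in_cons negb_or nxy xs ys.
- move=> w; rewrite !in_cons sM' M'E.
  have [->|_] := eqVneq w x; first by rewrite xM.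
  by have [->|_] := eqVneq w y; rewrite ?yM.
- have xno w : w \in s -> ~~ adj x w.
    rewrite sM' M'E => /and3P [wy _ wM]; by apply: contra wy => /nbr_x ->.
  have yno w : w \in s -> ~~ adj y w.
    rewrite sM' M'E => /and3P [_ wx wM]; by apply: contra wx => /nbr_y ->.
  move=> x0 [|[|i]] [|[|j]] /=; rewrite ?adj_irr ?xy // ?ltnS => ilt jlt.
  + by rewrite (negPf (xno _ _)) ?mem_nth.
  + by rewrite adj_sym xy.
  + by rewrite (negPf (yno _ _)) ?mem_nth.
  + by rewrite adj_sym (negPf (xno _ _)) ?mem_nth.
  + by rewrite adj_sym (negPf (yno _ _)) ?mem_nth.
  + by rewrite sadj.
Qed.

Lemma giso_matching (G : graph) :
  (forall x y z : G, adj x y -> adj x z -> y = z) ->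
  (forall x y : G, (forall w, ~~ adj x w) -> (forall w, ~~ adj y w) -> x = y) ->
  giso (partial_matching #|G| #|G|./2) G.
Proof.
move=> match_G iso_G.
have [||s [us sG sadj]] := @matching_enum G [set: G].
- by move=> x y z _ _ _; apply: match_G.
- by move=> x y _ _ isox isoy; apply: iso_G => w; [apply: isox|apply: isoy].
have size_s : size s = #|G|.
  by rewrite -(card_uniqP us) -cardsT; apply: eq_card.
have [/card0_eq G0|/card_gt0P [x0 _]] := posnP #|G|.
  have noI : 'I_#|G| -> False by move=> i; have := G0 (enum_val i).
  exists (fun i => enum_val i); last by move=> i; case: (noI i).
  by apply: inj_card_bij; [exact: enum_val_inj|rewrite card_ord].
exists (fun i : 'I_#|G| => nth x0 s i).
  apply: inj_card_bij; last by rewrite card_ord.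
  by move=> i j /eqP; rewrite nth_uniq ?size_s // => /eqP /val_inj.
move=> i j; rewrite sadj ?size_s // [in RHS]/adj /= -val_eqE.
case: (boolP (val i != val j)) => //= ij; case: (boolP (i./2 == j./2)) => //= ij2.
apply/esym; have := ltn_ord i; have := ltn_ord j.
by move: ij ij2; move: (#|G|) (val i) (val j) => n a b /eqP ab /eqP ab2 bn an; lia.
Qed.

(** All vertices of F except three are placed on hubs, which are adjacent to
    everything else. *)
Lemma hub_embed (F G : graph) (L : {set G}) (f1 f2 f3 : F) (a1 a2 a3 : G) :
  #|F| <= #|L| + 3 ->
  (forall x y, x \in L -> x != y -> adj x y) ->
  [/\ f1 != f2, f2 != f3 & f1 != f3] -> [/\ a1 != a2, a2 != a3 & a1 != a3] ->
  [/\ a1 \notin L, a2 \notin L & a3 \notin L] ->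
  (adj f1 f2 -> adj a1 a2) -> (adj f2 f3 -> adj a2 a3) -> (adj f1 f3 -> adj a1 a3) ->
  has_model F G.
Proof.
move=> cardF hubL [f12 f23 f13] [a12 a23 a13] [a1L a2L a3L] h12 h23 h13.
pose A := ~: [set f1; f2; f3].
have cardA : #|A| <= #|L|.
  have := cardsC [set f1; f2; f3]; rewrite -/A.
  have -> : #|[set f1; f2; f3]| = 3.
    by rewrite finset.setUC cardsU1 cards2 !inE f12 negb_or ![f3 == _]eq_sym f13 f23.
  by move=> E; rewrite -(leq_add2l 3) E addnC.
have [j jI jL] := inj_into a1 cardA.
pose h f := if f == f1 then a1 else if f == f2 then a2 else if f == f3 then a3 else j f.
have inA f : f != f1 -> f != f2 -> f != f3 -> f \in A.
  by move=> n1 n2 n3; rewrite !inE !negb_or n1 n2 n3.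
have hP f : [\/ f = f1, f = f2, f = f3 | f \in A].
  have [->|n1] := eqVneq f f1; first by constructor 1.
  have [->|n2] := eqVneq f f2; first by constructor 2.
  have [->|n3] := eqVneq f f3; first by constructor 3.
  by constructor 4; apply: inA.
have h1 : h f1 = a1 by rewrite /h eqxx.
have h2 : h f2 = a2 by rewrite /h eqxx eq_sym (negPf f12).
have h3 : h f3 = a3 by rewrite /h eqxx ![f3 == _]eq_sym (negPf f13) (negPf f23).
have hA f : f \in A -> h f = j f.
  by rewrite /h !inE !negb_or => /andP [/andP [/negPf -> /negPf ->] /negPf ->].
have hL f : f \in A -> h f \in L by move=> fA; rewrite hA // jL.
have nL a f : a \notin L -> f \in A -> a = h f -> False.
  by move=> aL /hL fL E; rewrite E fL in aL.
have hI : injective h.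
  move=> f f' E; case: (hP f) (hP f') => [fE|fE|fE|fA] [f'E|f'E|f'E|f'A];
  rewrite ?fE ?f'E // in E *; rewrite ?h1 ?h2 ?h3 in E;
  try (by case: (nL _ _ _ f'A E)); try (by case: (nL _ _ _ fA (esym E)));
  try (by case/eqP: a12); try (by case/eqP: a23); try (by case/eqP: a13).
  by move: E; rewrite !hA //; apply: jI.
apply: (has_model_hom hI) (has_model_refl F) => f f' ff'.
have nff' : h f != h f' by rewrite (inj_eq hI) adj_neq.
case: (hP f) => [fE|fE|fE|fA]; last by apply: hubL; rewrite ?hL.
all: case: (hP f') => [f'E|f'E|f'E|f'A];
  last by rewrite adj_sym; apply: hubL; rewrite ?hL // eq_sym.
all: rewrite fE f'E ?adj_irr // ?h1 ?h2 ?h3 in ff' nff' *; try (by rewrite adj_irr in ff').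
all: auto.
all: by rewrite adj_sym; rewrite adj_sym in ff'; auto.
Qed.

(** * Complete graphs minus the edges of a subgraph *)
Section CompleteMinusEdges.
Variables (r : nat) (H : subgraph (complete r)).
Local Notation F := (del_edges H).

Lemma adj_del_edgesE (f g : F) : adj f g = (f != g) && ~~ sub_adj H f g.
Proof. by []. Qed.

Lemma card_del_edges : #|F| = r.
Proof. by rewrite card_ord. Qed.

Lemma leq_clique_number (A : {set H}) : clique A -> #|A| <= clique_number H.
Proof. by move=> cA; apply: (@leq_bigmax_cond _ (@clique H) (fun A : {set H} => #|A|)). Qed.

Lemma exists_independent : exists2 A : {set F}, #|A| = clique_number H &
  forall f g, f \in A -> g \in A -> ~~ adj f g.
Proof.
have [|A /= cA maxA] := @eq_bigmax_cond _ [pred A : {set H} | clique A] (fun A => #|A|).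
  apply/card_gt0P; exists set0; rewrite inE; apply/forall_inP => x; by rewrite inE.
exists [set val x | x in A].
  by rewrite card_imset; [rewrite -maxA|exact: val_inj].
move=> _ _ /imsetP [x xA ->] /imsetP [y yA ->].
rewrite negb_and !negbK.
have [->|xy] := eqVneq x y; first by rewrite eqxx.
apply/orP; right; have /forall_inP /(_ x xA) /forall_inP /(_ y yA) /implyP := cA.
exact.
Qed.

(** An independent set of F with at least two vertices consists of vertices
    covered by edges of H, and is a clique there; for a single vertex the bound
    needs a vertex of H. *)
Lemma independent_le (Z : {set F}) : 0 < #|H| ->
  (forall f g, f \in Z -> g \in Z -> ~~ adj f g) -> #|Z| <= clique_number H.
Proof.
move=> /card_gt0P [h _] indZ.
have [Z1|Z1] := leqP #|Z| 1.
  apply: leq_trans Z1 _; rewrite -(cards1 h); apply: leq_clique_number.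
  by apply/forall_inP => x; rewrite inE => /eqP ->; apply/forall_inP => y; rewrite inE => /eqP ->; rewrite eqxx.
have subZ f g : f \in Z -> g \in Z -> f != g -> sub_adj H f g.
  by move=> fZ gZ fg; move: (indZ f g fZ gZ); rewrite adj_del_edgesE fg negbK.
have vZ f : f \in Z -> f \in sub_vertices H.
  move=> fZ; have /card_gt1P [x [y [xZ yZ xy]]] := Z1.
  have [fx|fx] := eqVneq f x.
    by apply: (@sub_adj_vertices _ H f y); apply: subZ; rewrite // fx.
  by apply: (@sub_adj_vertices _ H f x); apply: subZ.
pose A : {set H} := [set x | val x \in Z].
have <- : #|A| = #|Z|.
  rewrite -(card_imset _ (val_inj : injective (val : H -> complete r))).
  apply: eq_card => f; apply/imsetP/idP => [[x + ->]|fZ]; first by rewrite inE.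
  by exists (exist _ f (vZ f fZ)); rewrite ?inE.
apply: leq_clique_number; apply/forall_inP => x; rewrite inE => xZ.
apply/forall_inP => y; rewrite inE => yZ; apply/implyP => xy.
by apply: subZ => //; rewrite (inj_eq val_inj).
Qed.

Lemma exists_edge (Z : {set F}) : 0 < #|H| -> clique_number H < #|Z| ->
  exists f g, [/\ f \in Z, g \in Z & adj f g].
Proof.
move=> H0 big; have [/existsP [f /existsP [g /and3P [fZ gZ fg]]]|none] :=
    boolP [exists f : F, exists g : F, [&& f \in Z, g \in Z & adj f g]].
  by exists f, g.
suff : #|Z| <= clique_number H by rewrite leqNgt big.
apply: independent_le => // f g fZ gZ.
by apply: contra none => fg; apply/existsP; exists f; apply/existsP; exists g; rewrite fZ gZ.
Qed.

Definition matching_edges := forall x y z, sub_adj H x y -> sub_adj H x z -> y = z.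

Lemma discard_isolated_vertex (x y : complete r) : sub_adj H x y ->
  exists x' : discard_isolated H, val (val x') = x.
Proof.
move=> xy; have xH := sub_adj_vertices xy.
have yH : y \in sub_vertices H by apply: (@sub_adj_vertices _ H y x); rewrite sub_adj_sym.
pose u : H := exist _ x xH; pose v : H := exist _ y yH.
have uI : u \in [set x : H | [exists y, adj x y]].
  by rewrite inE; apply/existsP; exists v.
by exists (exist _ u uI).
Qed.

Lemma giso_matching_edges k : giso (discard_isolated H) (copies_K2 k) -> matching_edges.
Proof.
case=> f fB fM x y z xy xz.
have [x' x'E] := discard_isolated_vertex xy.
have [y' y'E] : exists y' : discard_isolated H, val (val y') = y.
  by apply: (@discard_isolated_vertex y x); rewrite sub_adj_sym.
have [z' z'E] : exists z' : discard_isolated H, val (val z') = z.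
  by apply: (@discard_isolated_vertex z x); rewrite sub_adj_sym.
have xy' : adj x' y' by rewrite -x'E -y'E in xy.
have xz' : adj x' z' by rewrite -x'E -z'E in xz.
rewrite -y'E -z'E; congr (val (val _)); apply: (bij_inj fB).
move: xy' xz'; rewrite -!fM /adj /= => /and3P [n1 /eqP e1 _] /and3P [n2 /eqP e2 _].
apply/val_inj => /=; move: n1 n2 e1 e2; rewrite -!val_eqE /=.
by move: (val (f x')) (val (f y')) (val (f z')) => a b c /eqP ab /eqP ac ab2 ac2; lia.
Qed.

(** The discarded graph has no isolated vertex, which rules out the odd order, where
    the last vertex of the partial matching is uncovered. *)
Lemma matching_edges_giso : matching_edges ->
  giso (discard_isolated H) (copies_K2 #|discard_isolated H|./2).
Proof.
move=> match_H; set H' := discard_isolated H.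
have iso_H' (x : H') : exists y, adj x y.
  have := valP x; rewrite inE => /existsP [y xy].
  have yI : y \in [set x : H | [exists y, adj x y]].
    by rewrite inE; apply/existsP; exists (val x); rewrite adj_sym.
  by exists (exist _ y yI).
have giso_H' : giso (partial_matching #|H'| #|H'|./2) H'.
  apply: giso_matching => [x y z xy xz|x y iso_x _].
    by apply/val_inj/val_inj; apply: (match_H (val (val x))).
  by have [w xw] := iso_H' x; have := iso_x w; rewrite xw.
suff even : (#|H'|./2).*2 = #|H'|.
  by apply: giso_sym; rewrite /copies_K2 even.
have := odd_double_half #|H'|; case: (boolP (odd _)) => //= oddH _.
case: giso_H' => f fB fM.
have ltH : #|H'|.-1 < #|H'| by rewrite prednK //; case: #|H'| oddH.
have [f' fK f'K] := fB.
have [w] := iso_H' (f (Ordinal ltH)); rewrite -(f'K w) fM /adj /= -val_eqE /=.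
have := ltn_ord (f' w); move: oddH ltH; move: #|H'| (val (f' w)) => n b on ln bn.
by case/and3P => /eqP nb /eqP e _; lia.
Qed.

End CompleteMinusEdges.

(** * The extremal graphs *)
Section HubGraph.
Variables (G : graph) (L : {set G}).
Hypothesis hubL : forall x y, x \in L -> x != y -> adj x y.
Let e : rel G := fun x y => (x != y) && ((x \in L) || (y \in L)).

Fact hub_graph_sym : symmetric e.
Proof. by move=> x y; rewrite /e eq_sym orbC. Qed.

Fact hub_graph_irr : irreflexive e.
Proof. by move=> x; rewrite /e eqxx. Qed.

Definition hub_graph : graph := Graph hub_graph_sym hub_graph_irr.

Lemma hub_graph_sub x y : e x y -> adj x y.
Proof.
by case/andP=> xy /orP [] xL; [|rewrite adj_sym]; apply: hubL; rewrite // eq_sym.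
Qed.

Lemma spanning_book s t : #|L| = s -> #|~: L| = t -> has_spanning_subgraph G (book s t).
Proof.
move=> cardL cardR.
have vT x y : e x y -> x \in [set: G] by rewrite inE.
exists (Subgraph hub_graph_sym hub_graph_sub vT); split=> //.
apply: (@giso_trans _ hub_graph).
  exists val => //; apply: inj_card_bij; first exact: val_inj.
  by rewrite card_sig; apply/subset_leq_card/subsetP=> x _; rewrite inE.
apply/giso_sym; apply: (@giso_join_hubs hub_graph L) => //.
  by move=> x y xL xy; rewrite /adj /= /e xy xL.
apply: giso_edgeless; first by rewrite card_induced.
move=> x y; rewrite /adj /= /e; have := valP x; have := valP y.
by rewrite !inE => /negPf -> /negPf ->; rewrite andbF.
Qed.
End HubGraph.

(** Three vertices carry at most one edge of H. *)
Lemma path_in_triple r (H : subgraph (complete r)) (Z : {set del_edges H}) :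
  matching_edges H -> 2 < #|Z| ->
  exists f g h, [/\ [/\ f \in Z, g \in Z & h \in Z], f != h, adj g f & adj g h].
Proof.
move=> match_H /card_gt2P [f [g [h [[fZ gZ hZ] [fg gh hf]]]]].
have noloop x : sub_adj H x x -> False by move/sub_adj_adj; rewrite adj_irr.
have [sfg|nfg] := boolP (sub_adj H f g).
  exists f, h, g; split=> //; rewrite adj_del_edgesE ?hf 1?[h == g]eq_sym ?gh /=.
    apply/negP=> shf; case/eqP: gh; apply: (match_H f) => //.
    by rewrite sub_adj_sym.
  apply/negP=> shg; case/eqP: hf; apply: (match_H g); by rewrite sub_adj_sym.
have [sgh|ngh] := boolP (sub_adj H g h).
  exists g, f, h; split=> //; rewrite 1?eq_sym // adj_del_edgesE ?fg ?nfg //.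
  rewrite eq_sym hf /=; apply/negP=> sfh; case/eqP: fg.
  by apply: (match_H h); rewrite sub_adj_sym.
exists f, g, h; split; rewrite // 1?[f == h]eq_sym ?hf // adj_del_edgesE ?gh ?ngh //.
by rewrite eq_sym fg /= sub_adj_sym.
Qed.

Section EdgeMaximality.
Local Open Scope ring_scope.
Variables (R : realType) (G : graph) (l x y : G).
Hypothesis hub : forall v, v != l -> adj l v.
Hypotheses (xy : x != y) (nxy : ~~ adj x y).

(** The added edge is the rewiring with hubs x and y and without twins. Positivity of
    the Perron vector, which makes the inequality strict, spreads from l to all
    other vertices. *)
Lemma add_edge_radius :
  spectral_radius R G < spectral_radius R (rewire [set x; y] set0).
Proof.
have G0 : (0 < #|G|)%N by apply/card_gt0P; exists l.
have [z [z0 _ [v0 zv0] zE]] := @perron_normalized R G G0.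
set lam := spectral_radius R G in zE *.
have spread u w : 0 < z u -> adj w u -> 0 < lam /\ 0 < z w.
  move=> zu wu; have : 0 < lam * z w.
    rewrite -zE (bigD1 u) //=; apply: ltr_pwDl zu _; exact: sumr_ge0.
  have := z0 w; rewrite le_eqVlt => /orP [/eqP <-|zw]; first by rewrite mulr0 ltxx.
  by rewrite pmulr_lgt0.
have zl : 0 < z l.
  have [<-|vl] := eqVneq v0 l; first by rewrite zv0.
  by have [] := @spread v0 l; rewrite ?zv0 // hub.
have pos w : 0 < z w.
  have [->//|wl] := eqVneq w l.
  by have [] := @spread l w zl; rewrite // adj_sym hub.
have lam0 : 0 < lam.
  have [xl|xl] := eqVneq x l.
    by have [] := @spread l y zl; rewrite // adj_sym hub // -xl eq_sym.
  by have [] := @spread l x zl; rewrite // adj_sym hub.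
apply: (rewire_radius_lt _ z0 lam0 zE G0).
  by rewrite -setI_eq0 setI0.
rewrite big_set0 addr0 (bigD1 x) ?inE ?eqxx //= (bigD1 y) /=; last first.
  by rewrite !inE eqxx orbT xy nxy.
apply: ltr_pwDl; last by apply: sumr_ge0 => v _; rewrite mulr_ge0 // sumr_ge0.
apply: mulr_gt0 => //; apply: ltr_pwDl => //; exact: sumr_ge0.
Qed.
End EdgeMaximality.

Theorem theorem1p6 (R : realType) (r : nat) (H : subgraph (complete r))
  (H_nonempty : 0 < #|H|)
  (gamma_ge1 : 1 <= r - clique_number H - 1) :
  let gamma := r - clique_number H - 1 in
  exists N : nat, forall n : nat, N <= n ->
  forall G : graph, in_SPEX_minor R n (del_edges H) G ->
    has_spanning_subgraph G (book gamma (n - gamma)) /\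
    (clique_number H = 2 ->
       let H' := discard_isolated H in
       (giso H' (copies_K2 #|H'|./2) ->
          giso G (book_edges (n - r + 3)./2 (r - 3) (n - r + 3))) /\
       (~ giso H' (copies_K2 #|H'|./2) ->
          giso G (book (r - 3) (n - r + 3)))).
Proof.
move=> gamma; have [A cardA indA] := exists_independent H.
have rE : r = clique_number H + gamma.+1 by rewrite /gamma; lia.
have cardAC : #|~: A| <= gamma.+1.
  have E := cardsC A; rewrite cardA card_del_edges in E.
  by rewrite -(leq_add2l (clique_number H)) E -rE.
have edgeF (Z : {set del_edges H}) : #|del_edges H| <= #|Z| + gamma ->
    exists f f', [/\ f \in Z, f' \in Z & adj f f'].
  rewrite card_del_edges => le; apply: exists_edge => //.
  by rewrite -(leq_add2r gamma) addSnnS -rE.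
have [N NP] := extremal_hubs R gamma_ge1 indA cardAC edgeF.
exists (N + r) => n Nn G ext; have [cardG nF max_rho] := ext.
have [L cardL hubL] := NP n G (leq_trans (leq_addr r N) Nn) ext.
have rn : r <= n by apply: leq_trans Nn; apply: leq_addl.
have nM : ~ has_model (del_edges H) G by move/has_model_minor.
have cardR : #|~: L| = n - gamma.
  by rewrite cardsCs finset.setCK cardG cardL.
split; first exact: (spanning_book hubL cardL cardR).
move=> omega2 H'.
have gE : gamma = r - 3 by rewrite /gamma omega2; lia.
have r4 : 3 < r by move: gamma_ge1; rewrite omega2; lia.
have tE : n - gamma = n - r + 3 by rewrite gE; lia.
rewrite tE in cardR; rewrite -/gamma gE in cardL.
have cardF : #|del_edges H| <= #|L| + 3 by rewrite card_del_edges cardL; lia.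
have notL v : (v \in ~: L) = (v \notin L) by rewrite inE.
split=> [isoH|nisoH]; apply: giso_sym; apply: (giso_join_hubs cardL hubL).
  have match_H : matching_edges H := giso_matching_edges isoH.
  (* An edge f1 f3 of H and a third vertex f2 span in F at most the path f1 f2 f3. *)
  have [f1 [f3 [f13 AE]]] : exists f1 f3, f1 != f3 /\ A = [set f1; f3].
    by apply/cards2P; rewrite cardA omega2.
  have [f2 f2A] : exists f2, f2 \in ~: A.
    apply/card_gt0P; have := cardsC A; rewrite cardA omega2 card_del_edges; lia.
  have match_G x y z : x \notin L -> y \notin L -> z \notin L ->
      adj x y -> adj x z -> y = z.
    move=> xL yL zL xy xz; apply/eqP/contraT => yz; exfalso; apply: nM.
    have := f2A; rewrite AE !inE negb_or => /andP [f21 f23].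
    apply: (@hub_embed _ _ L f1 f2 f3 y x z cardF hubL) => //.
    - by split; rewrite // eq_sym.
    - by split; rewrite ?(adj_neq xz) // eq_sym (adj_neq xy).
    - by move=> _; rewrite adj_sym.
    - by have := indA f1 f3; rewrite AE !in_set2 !eqxx orbT => /(_ isT isT) /negPf ->.
  have <- : #|induced (~: L)| = n - r + 3 by rewrite card_induced.
  apply: giso_matching => [x y z xy xz|x y iso_x iso_y].
    by apply: val_inj; apply: (match_G (val x)) => //; rewrite -notL; apply: valP.
  apply/eqP/contraT => xy; exfalso.
  have isoL u : (forall w, ~~ @adj (induced (~: L)) u w) ->
      forall w, w \notin L -> ~~ adj (val u) w.
    by move=> iso w; rewrite -notL => wL; apply: (iso (exist _ w wL)).
  have {iso_x} iso_x := isoL x iso_x; have {iso_y} iso_y := isoL y iso_y.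
  have [xL yL] : val x \notin L /\ val y \notin L by rewrite -!notL !(valP x) !(valP y).
  have vxy : val x != val y by rewrite (inj_eq val_inj).
  have [l lL] : exists l, l \in L.
    by apply/card_gt0P; rewrite cardL -gE.
  have := @add_edge_radius R G l (val x) (val y) _ vxy (iso_x _ yL).
  rewrite ltNge max_rho => [/(_ _)/negP []|//|] //.
    by move=> v vl; apply: hubL => //; rewrite eq_sym.
  move/minor_has_model.
  apply: (@matching_rest_model_free _ (rewire [set val x; val y] set0) L).
    have pair a b : a \notin L -> b \notin L ->
        @adj (rewire [set val x; val y] set0) a b ->
        [\/ a = val x /\ b = val y, a = val y /\ b = val x |
            [/\ a != val x, a != val y & @adj G a b]].
      move=> aL bL; rewrite adj_rewireE => /andP [ab].
      rewrite !setU0 !in_set0 /= => adj_ab.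
      have : (a \in [set val x; val y]) && (b \in [set val x; val y]) || @adj G a b.
        by case/or3P: adj_ab => [->|/andP [-> ->]|->] //; rewrite orbT.
      case/orP=> [|gab]; last first.
        constructor 3; split=> //; apply: contraTneq gab => ->.
          exact: iso_x.
        exact: iso_y.
      rewrite !in_set2 => /andP [/orP [] /eqP aE /orP [] /eqP bE];
        rewrite aE bE ?eqxx // in ab *; by [constructor 1|constructor 2].
    move=> a b c aL bL cL /(pair a b aL bL) ab /(pair a c aL cL) ac.
    case: ab => [[aE bE]|[aE bE]|[ax ay ab]]; case: ac => [[aE' cE]|[aE' cE]|[ax' ay' ac]].
    - by rewrite bE cE.
    - by case/eqP: vxy; rewrite -aE -aE'.
    - by rewrite aE eqxx in ax'.
    - by case/eqP: vxy; rewrite -aE -aE'.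
    - by rewrite bE cE.
    - by rewrite aE eqxx in ay'.
    - by rewrite aE' eqxx in ax.
    - by rewrite aE' eqxx in ay.
    - exact: match_G ab ac.
  move=> Z; rewrite card_del_edges cardL => rZ.
  by apply: path_in_triple => //; lia.
apply: giso_edgeless; first by rewrite card_induced.
move=> a b; apply/negP=> ab; apply: nM.
have [y [z [x [xy xz yz]]]] : exists y z x, [/\ sub_adj H x y, sub_adj H x z & y != z].
  have [/existsP [y /existsP [z /existsP [x /and3P [xy xz yz]]]]|none] :=
    boolP [exists y, exists z, exists x, [&& sub_adj H x y, sub_adj H x z & y != z]].
    by exists y, z, x.
  case: nisoH; apply: matching_edges_giso => x y z xy xz.
  apply/eqP/contraT => yz; case/negP: none.
  by apply/existsP; exists y; apply/existsP; exists z; apply/existsP; exists x; rewrite xy xz.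
have [aL bL] : val a \notin L /\ val b \notin L by rewrite -!notL !(valP a) !(valP b).
have nab : val a != val b by rewrite (inj_eq val_inj) adj_neq.
have [c] : exists c, c \in (~: L) :\ val a :\ val b.
  apply/card_gt0P.
  have := cardsD1 (val b) (~: L :\ val a); have := cardsD1 (val a) (~: L).
  rewrite cardR notL aL in_setD1 notL bL eq_sym nab !add1n addn3 => -[<-].
  by move=> [<-].
rewrite !in_setD1 notL => /and3P [cb ca cL].
have noloop u v : sub_adj H u v -> u != v.
  by move=> uv; apply: contraTneq (sub_adj_adj uv) => ->; rewrite adj_irr.
apply: (@hub_embed (del_edges H) G L y z x (val a) (val b) c cardF hubL) => //.
- by split=> //; [rewrite eq_sym|rewrite eq_sym]; apply: noloop.
- by split=> //; rewrite eq_sym.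
- by rewrite adj_del_edgesE [sub_adj H z x]sub_adj_sym xz andbF.
- by rewrite adj_del_edgesE [sub_adj H y x]sub_adj_sym xy andbF.
Qed.
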